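(* Let $E,E'$ be real Banach spaces of dimension at least $2$, let $G\subsetneq E$ and $G'\subsetneq E'$ be domains, and let $f:G\to G'$ be a $\theta$-quasimöbius homeomorphism. (1) If $G$ is diameter $c$-uniform, then $G'$ is diameter $c'$-uniform with $c'$ depending only on $c$ and $\theta$. (2) If $G$ is $\delta$-uniform with $0<\delta<1$, then $G'$ is $\delta'$-uniform with some $\delta'\in(0,1)$ depending only on $\delta$ and $\theta$.
   Context: A domain is a nonempty connected open set; norms are written $|\cdot|$; $\partial G$ is the norm boundary and $d_G(x)=\operatorname{dist}(x,\partial G)$ for $x\in G$. For an arc $\alpha$ and $x,z\in\alpha$, $\alpha[x,z]$ is the subarc between $x$ and $z$. Quasimöbius: let $\theta:[0,\infty)\to[0,\infty)$ be a homeomorphism. For four distinct points $x,y,z,w$ the cross ratio is $\tau(x,y,z,w)=\frac{|x-z|}{|x-y|}\cdot\frac{|y-w|}{|z-w|}$. An embedding $f$ is $\theta$-quasimöbius if $\tau(f(x),f(y),f(z),f(w))\le\theta(\tau(x,y,z,w))$ for every quadruple of distinct points $x,y,z,w$ of its domain of definition. Diameter $c$-uniform ($c\ge1$): each pair of points $x_1,x_2\in G$ can be joined by an arc $\alpha$ in $G$ with $\operatorname{diam}\alpha\le c|x_1-x_2|$ and $\min_{j=1,2}\operatorname{diam}(\alpha[x_j,x])\le c\,d_G(x)$ for all $x\in\alpha$. $\delta$-uniform ($0<\delta<1$): each pair of (distinct) points $x_1,x_2\in G$ can be joined by an arc $\alpha$ in $G$ such that $$\frac{|x-y|}{|x-x_i|}\cdot\frac{|x_i-x_j|}{|x_j-y|}\ge\delta,\qquad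 i\ne j\in\{1,2\},$$ for all $x\in\alpha\setminus\{x_1,x_2\}$ and all $y\in E\setminus G$. (For $G'$ the same definitions are used in $E'$.) *)

(* Defs.v *)
From HB Require Import structures.
From mathcomp Require Import all_boot all_order all_algebra.
From mathcomp Require Import all_classical all_reals all_analysis.

Set Implicit Arguments.
Unset Strict Implicit.
Unset Printing Implicit Defensive.

Import Order.TTheory GRing.Theory Num.Theory.
Import numFieldNormedType.Exports.

Local Open Scope classical_set_scope.
Local Open Scope ring_scope.

Definition dim_ge2 (R : realType) (E : lmodType R) : Prop :=
  exists u v : E, forall a b : R, a *: u + b *: v = 0 -> a = 0 /\ b = 0.

(* The empty set is [connected] in the library. *)
Definition domain (T : topologicalType) (G : set T) : Prop :=
  [/\ open G, connected G & G !=set0].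

(* Only the restrictions of [f] to [A] and of [g] to [B] matter; [within] is
   continuity for the subspace topologies. *)
Definition homeomorphism_onto (T U : topologicalType) (A : set T) (B : set U)
    (f : T -> U) : Prop :=
  exists g : U -> T,
    [/\ {within A, continuous f} /\ {within B, continuous g},
        forall x, A x -> B (f x),
        forall y, B y -> A (g y),
        forall x, A x -> g (f x) = x &
        forall y, B y -> f (g y) = y].

Definition cross_ratio (R : realType) (E : normedModType R)
    (x y z w : E) : R :=
  (`|x - z| / `|x - y|) * (`|y - w| / `|z - w|).

Definition quasimobius (R : realType) (E E' : normedModType R)
    (theta : R -> R) (G : set E) (f : E -> E') : Prop :=
  forall x y z w : E, G x -> G y -> G z -> G w -> uniq [:: x; y; z; w] ->
    cross_ratio (f x) (f y) (f z) (f w) <= theta (cross_ratio x y z w).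

Definition boundary (T : topologicalType) (G : set T) : set T :=
  closure G `\` interior G.

Definition diam (R : realType) (E : normedModType R) (A : set E) : \bar R :=
  ereal_sup [set r | exists x y, [/\ A x, A y & r = `|x - y|%:E]].

Definition dist_boundary (R : realType) (E : normedModType R) (G : set E)
    (x : E) : \bar R :=
  ereal_inf [set `|x - y|%:E | y in boundary G].

(* The subarc between [gamma s] and [gamma t], for s <= t. *)
Definition subarc (R : realType) (E : normedModType R) (gamma : R -> E)
    (s t : R) : set E :=
  gamma @` `[s, t].

(* An arc is given by an injective continuous parametrization of [0, 1]; since
   [0, 1] is compact this is a homeomorphism onto its image
   [subarc gamma 0 1]. *)
Definition arc_joining (R : realType) (E : normedModType R) (G : set E)
    (x1 x2 : E) (gamma : R -> E) : Prop :=
  [/\ {within `[0, 1], continuous gamma},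
      {in `[0, 1] &, injective gamma},
      subarc gamma 0 1 `<=` G,
      gamma 0 = x1 &
      gamma 1 = x2].

(* For x1 = x2 the condition holds trivially for the degenerate arc {x1}. *)
Definition diameter_uniform (R : realType) (E : normedModType R) (c : R)
    (G : set E) : Prop :=
  forall x1 x2 : E, G x1 -> G x2 -> x1 != x2 ->
    exists gamma : R -> E,
      [/\ arc_joining G x1 x2 gamma,
          (diam (subarc gamma 0%R 1%R) <= (c * `|x1 - x2|)%:E)%E &
          forall t : R, 0 <= t <= 1 ->
            (Order.min (diam (subarc gamma 0%R t)) (diam (subarc gamma t 1%R))
               <= c%:E * dist_boundary G (gamma t))%E].

Definition delta_uniform (R : realType) (E : normedModType R) (delta : R)
    (G : set E) : Prop :=
  forall x1 x2 : E, G x1 -> G x2 -> x1 != x2 ->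
    exists gamma : R -> E,
      arc_joining G x1 x2 gamma /\
      forall x y : E, subarc gamma 0 1 x -> x != x1 -> x != x2 -> ~ G y ->
        delta <= (`|x - y| / `|x - x1|) * (`|x1 - x2| / `|x2 - y|) /\
        delta <= (`|x - y| / `|x - x2|) * (`|x2 - x1| / `|x1 - y|).

(* Main.v *)
Require Import Defs.
From HB Require Import structures.
From mathcomp Require Import all_boot all_order all_algebra.
From mathcomp Require Import all_classical all_reals all_analysis.
From mathcomp Require Import ring lra.

Set Implicit Arguments.
Unset Strict Implicit.
Unset Printing Implicit Defensive.

Import Order.TTheory GRing.Theory Num.Theory.
Import numFieldNormedType.Exports.

Local Open Scope classical_set_scope.
Local Open Scope ring_scope.

(** Both kinds of uniformity are compared with a condition that speaks of cross
    ratios only.  For x on an arc from x1 to x2 and y in the boundary of G, ask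
    that the cross ratios of (x, y, x1, x2) and of (x, y, x2, x1) be at most C;
    this is [moebius_uniform].  The same inequalities for y at infinity read
    |x - xi| <= C |x1 - x2|; adding them gives [bounded_moebius_uniform].

    A quasimoebius map distorts cross ratios in a controlled way, so it carries
    such arcs to such arcs, provided that a boundary point y' of G' can be
    replaced by points f z with z in G near the boundary of G in the extended
    sense.  This is [boundary_preimage]: if f z tends to y', then either z can
    be taken to converge to a boundary point of G (here completeness of E is
    used), or z can be taken to tend to infinity.  Because of the second case
    the condition at infinity has to be known in G, while nothing is obtained
    about infinity in G'; hence [moebius_transfer] goes from
    [bounded_moebius_uniform] to [moebius_uniform].

    The condition at infinity is then recovered in G' ([moebius_bounded]).  If
    an arc from x1 to x2 makes an excursion much longer than |x1 - x2|, its
    inequalities force the whole boundary into a ball about x2 of radius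
    comparable to |x1 - x2|.  In dimension at least 2 the excursion can be
    replaced by a path in an annulus around that ball, which is far from the
    boundary.

    A delta-uniform domain is clearly moebius uniform, and conversely an
    exterior point y is handled through the point where the segment from x to y
    crosses the boundary, at the cost of the condition at infinity.  A diameter
    uniform domain is bounded moebius uniform by the triangle inequality.  The
    way back ([bounded_moebius_diameter]) needs new arcs: the inequalities bound
    the distance of x to one of the endpoints by d(x), but not the diameter of
    the subarc.  Near each endpoint one joins points on geometrically growing
    spheres, chosen on the original arc, by arcs given by uniformity
    ([carrot_exists]).

    Concatenations of arcs have to be made injective without spoiling the
    control of initial subarcs; [arc_splice] does this by leaving the first arc
    at its first point on the second. *)

(** * Arcs *)

Lemma within_continuous_comp_within (T U V : topologicalType) (A : set T)
    (B : set U) (f : T -> U) (g : U -> V) :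
  {within A, continuous f} -> {within B, continuous g} ->
  (forall x, A x -> B (f x)) -> {within A, continuous (g \o f)}.
Proof.
move=> /subspace_continuousP fc /subspace_continuousP gc fAB.
apply/subspace_continuousP => x Ax.
apply: cvg_comp (gc _ (fAB _ Ax)) => S BS.
have fS : nbhs x [set y | A y -> B (f y) -> S (f y)] by exact: fc _ Ax _ BS.
by apply: (@filterS T (nbhs x) _ _ _ _ fS) => y fyS Ay; exact: fyS Ay (fAB _ Ay).
Qed.

Lemma within_normP (R : realType) (V W : pseudoMetricNormedZmodType R)
    (A : set V) (f : V -> W) :
  {within A, continuous f} <->
  forall x, A x -> forall e, 0 < e -> exists2 d, 0 < d &
    forall y, A y -> `|x - y| < d -> `|f x - f y| < e.
Proof.
split.
  move=> /subspace_continuousP fc x Ax e e0.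
  have /cvgrPdist_lt /(_ _ e0) := fc _ Ax.
  rewrite /within /= => /nbhs_ballP[d /= d0 dA]; exists d => // y Ay xy.
  by apply: dA => //; rewrite -ball_normE.
move=> fc; apply/subspace_continuousP => x Ax.
apply/cvgrPdist_lt => e e0; have [d d0 dA] := fc _ Ax _ e0.
rewrite /within /=; apply/nbhs_ballP; exists d => // y.
by rewrite -ball_normE /= => xy Ay; apply: dA.
Qed.

Section Arcs.
Variables (R : realType) (E : normedModType R).
Implicit Types (A B : set E) (a b c p x y z : E) (f g : R -> E).

Lemma itv01E (t : R) : (t \in `[0, 1]) = (0 <= t <= 1).
Proof. by rewrite in_itv. Qed.

Lemma arc_cont A a b f : arc_joining A a b f ->
  {within `[0, 1], continuous f}.
Proof. by case. Qed.

Lemma arc_in A a b f t : arc_joining A a b f -> 0 <= t <= 1 -> A (f t).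
Proof. by case=> _ _ fA _ _ t01; apply: fA; exists t => //=; rewrite in_itv. Qed.

Lemma arc_inj A a b f s t : arc_joining A a b f -> 0 <= s <= 1 -> 0 <= t <= 1 ->
  f s = f t -> s = t.
Proof. by case=> _ fi _ _ _ s01 t01; apply: fi; rewrite itv01E. Qed.

Lemma arc_sub A B a b f : A `<=` B -> arc_joining A a b f -> arc_joining B a b f.
Proof. by move=> AB [fc fi fA f0 f1]; split=> //; exact: subset_trans AB. Qed.

Lemma arc_restr A B a b f : (forall t, 0 <= t <= 1 -> B (f t)) ->
  arc_joining A a b f -> arc_joining B a b f.
Proof.
move=> fB [fc fi fA f0 f1]; split=> // x [t /=]; rewrite itv01E => t01 <-.
exact: fB.
Qed.

Lemma continuous_affine (k m : R) : continuous (fun t : R => k * t + m).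
Proof.
move=> t; apply: cvgD; last exact: cvg_cst.
by apply: cvgM; [exact: cvg_cst|exact: cvg_id].
Qed.


Lemma arc_piece A B a b f (s t : R) : arc_joining A a b f -> 0 <= s <= 1 ->
  0 <= t <= 1 -> s != t ->
  (forall u, 0 <= u <= 1 -> B (f ((t - s) * u + s))) ->
  arc_joining B (f s) (f t) (fun u => f ((t - s) * u + s)).
Proof.
move=> fA /andP[s0 s1] /andP[t0 t1] st fB.
have st01 u : 0 <= u <= 1 -> 0 <= (t - s) * u + s <= 1.
  by move=> /andP[u0 u1]; apply/andP; split; nra.
split.
- suff : {within `[0, 1], continuous (f \o (fun u => (t - s) * u + s))} by [].
  refine (@within_continuous_comp_within R R E `[0, 1]%classic `[0, 1]%classic (fun u => (t - s) * u + s) f _ _ _).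
  + exact/continuous_subspaceT/continuous_affine.
  + exact: arc_cont fA.
  + by move=> u /=; rewrite !itv01E; exact: st01.
- move=> u v; rewrite !itv01E => u01 v01.
  move=> /(arc_inj fA (st01 _ u01) (st01 _ v01)) /addIr /mulfI; apply.
  by rewrite subr_eq0 eq_sym.
- by move=> x [u /=]; rewrite itv01E => u01 <-; exact: fB.
- by rewrite mulr0 add0r.
- by rewrite mulr1 subrK.
Qed.

Lemma arc_rev A a b f : arc_joining A a b f ->
  arc_joining A b a (fun u => f (1 - u)).
Proof.
move=> fA; have e u : 1 - u = (0 - 1) * u + 1 :> R by ring.
have [_ _ _ f0 f1] := fA.
rewrite -{1}f0 -{1}f1 (_ : (fun u => _) = fun u => f ((0 - 1) * u + 1)).
  apply: (arc_piece fA); rewrite ?lexx ?ler01 ?oner_eq0 //.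
  by move=> u /andP[u0 u1]; apply: (arc_in fA); apply/andP; split; lra.
by apply/funext => u; rewrite e.
Qed.

(** The first parameter is an infimum; it is a hit because [K] is closed. *)
Lemma arc_first_hit f (K : set E) (s0 : R) : {within `[0, 1], continuous f} ->
  closed K -> 0 <= s0 <= 1 -> K (f s0) ->
  exists s, [/\ 0 <= s <= s0, K (f s) & forall u, 0 <= u < s -> ~ K (f u)].
Proof.
move=> fc Kc s001 Ks0.
pose S := [set u : R | 0 <= u <= 1 /\ K (f u)].
have S0 : S s0 by [].
have lbS : lbound S 0 by move=> u [/andP[]].
have hiS : has_inf S by split; [exists s0|exists 0].
have ilb : lbound S (inf S) by move=> u Su; exact: ge_inf hiS.2 _ Su.
have i0 : 0 <= inf S by apply: lb_le_inf lbS; exists s0.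
have is0 : inf S <= s0 by exact: ilb.
have i1 : inf S <= 1 by apply: le_trans is0 _; case/andP: s001.
exists (inf S); split; first by rewrite i0.
- apply: contrapT => Ki.
  have : nbhs (f (inf S)) (~` K) by apply: open_nbhs_nbhs; split=> //; exact: closed_openC.
  move=> /nbhs_ballP[e /= e0 eK].
  have i01 : `[0, 1]%classic (inf S) by rewrite /= itv01E i0.
  have [d d0 dP] := (within_normP _ _).1 fc _ i01 _ e0.
  have [u Su ud] := inf_adherent d0 hiS.
  have [u01 Ku] := Su.
  apply: (eK (f u)) => //; rewrite -ball_normE /=; apply: dP.
    by rewrite /= itv01E.
  by rewrite ler0_norm ?subr_le0; [move: ud; lra|exact: ilb].
- move=> u /andP[u0 ui] Ku.
  have : inf S <= u by apply: ilb; split=> //; rewrite u0; lra.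
  by rewrite leNgt ui.
Qed.

Lemma subarc_closed f : {within `[0, 1], continuous f} -> closed (subarc f 0 1).
Proof.
move=> fc; apply: compact_closed; first exact: norm_hausdorff.
by apply: continuous_compact fc _; exact: segment_compact.
Qed.

Lemma subarcP f (s t : R) x :
  subarc f s t x <-> exists2 u, s <= u <= t & f u = x.
Proof. by split=> -[u]; rewrite /= ?in_itv /= => ut <-; exists u; rewrite //= in_itv. Qed.

(** The arc [f] is followed up to its first point [f s = g t] on [g], and then
    [g] is followed backwards from [g t]; stopping at the first common point
    makes the result injective.  The second part of the conclusion keeps track
    of the order: seen from either end, an initial subarc of [h] lies in an
    initial subarc of [f] or of [g], so estimates on initial subarcs survive. *)
Lemma arc_splice A B a b c f g : arc_joining A a b f -> arc_joining B c b g ->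
  a != c -> exists h,
  arc_joining (A `|` B) a c h /\
  forall u, 0 <= u <= 1 ->
    (exists s, [/\ 0 <= s <= 1, h u = f s & subarc h 0 u `<=` subarc f 0 s]) \/
    (exists t, [/\ 0 <= t <= 1, h u = g t & subarc h u 1 `<=` subarc g 0 t]).
Proof.
move=> fA gB ac; have [_ _ _ f0 f1] := fA; have [_ _ _ g0 g1] := gB.
have [s [/andP[s0 s1]]] : exists s, [/\ 0 <= s <= 1, subarc g 0 1 (f s) &
    forall u, 0 <= u < s -> ~ subarc g 0 1 (f u)].
  apply: arc_first_hit; [exact: arc_cont fA|exact/subarc_closed/(arc_cont gB)| |].
    by rewrite ler01 lexx.
  by rewrite f1 -g1; apply/subarcP; exists 1 => //; rewrite lexx ler01.
move=> /subarcP[t /andP[t0 t1] gt] fNg.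
(* Keeping the parameters of [f] and [g], the two pieces take total time
   [s + t]. *)
have L0 : 0 < s + t.
  rewrite lt_neqAle addr_ge0// andbT; apply/eqP => st0.
  have [s00 t00] : s = 0 /\ t = 0 by split; lra.
  by move/eqP: ac; apply; rewrite -f0 -g0; move: gt; rewrite s00 t00.
pose k := s / (s + t).
have kE : (s + t) * k = s by rewrite /k mulrC divfK// gt_eqF.
have k0 : 0 <= k by rewrite /k divr_ge0// ltW.
have k1 : k <= 1 by rewrite /k ler_pdivrMr// mul1r lerDl.
pose h u := if u <= k then f ((s + t) * u) else g ((s + t) - (s + t) * u).
have h1 u : u <= k -> h u = f ((s + t) * u) by rewrite /h => ->.
have h2 u : k <= u -> h u = g ((s + t) - (s + t) * u).
  rewrite le_eqVlt => /predU1P[<-|ku]; last by rewrite /h leNgt ku.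
  by rewrite h1// kE -gt; congr g; lra.
have r1 u : 0 <= u <= k -> 0 <= (s + t) * u <= s.
  by move=> /andP[u0 uk]; rewrite mulr_ge0 ?(ltW L0)//= -[X in _ <= X]kE ler_pM2l.
have r2 u : k <= u <= 1 -> 0 <= (s + t) - (s + t) * u <= t.
  move=> /andP[ku u1]; have : (s + t) * k <= (s + t) * u by rewrite ler_pM2l.
  have : (s + t) * u <= (s + t) * 1 by rewrite ler_pM2l.
  by rewrite kE mulr1; lra.
have r1' u : 0 <= u <= k -> 0 <= (s + t) * u <= 1 by move=> /r1; lra.
have r2' u : k <= u <= 1 -> 0 <= (s + t) - (s + t) * u <= 1 by move=> /r2; lra.
exists h; split; last first.
  move=> u /andP[u0 u1]; case: (leP u k) => uk.
    left; exists ((s + t) * u); split.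
    - by apply: r1'; rewrite u0.
    - exact: h1.
    - move=> x /subarcP[v /andP[v0 vu] <-]; apply/subarcP.
      exists ((s + t) * v); first by rewrite mulr_ge0 ?(ltW L0)//= ler_pM2l.
      by rewrite h1//; lra.
  right; exists ((s + t) - (s + t) * u); split.
  - by apply: r2'; rewrite u1 ltW.
  - by apply: h2; exact: ltW.
  - move=> x /subarcP[v /andP[uv v1] <-]; apply/subarcP.
    have kv : k <= v by lra.
    exists ((s + t) - (s + t) * v); last by rewrite h2.
    have /andP[-> _] : 0 <= (s + t) - (s + t) * v <= t by apply: r2; rewrite kv.
    by rewrite /= lerD2l lerN2 ler_pM2l.
split.
- have -> : `[0, 1]%classic = `[0, k]%classic `|` `[k, 1]%classic :> set R.
    apply/seteqP; split=> u /=; rewrite !in_itv /=.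
      by move=> /andP[u0 u1]; case: (leP u k) => uk; [left|right]; rewrite ?u0 ?u1 ?(ltW uk).
    by case=> /andP[u0 u1]; apply/andP; split; lra.
  apply: withinU_continuous; [exact: interval_closed..| |].
  + apply: (@subspace_eq_continuous _ _ _ (f \o (fun u => (s + t) * u + 0))).
      move=> u; rewrite inE /= in_itv /= => /andP[u0 uk].
      by rewrite addr0 [RHS]h1.
    refine (@within_continuous_comp_within R R E _ `[0, 1]%classic (fun u => (s + t) * u + 0) f _ _ _).
    * exact/continuous_subspaceT/continuous_affine.
    * exact: arc_cont fA.
    * by move=> u /=; rewrite !in_itv /= addr0; exact: r1'.
  + apply: (@subspace_eq_continuous _ _ _ (g \o (fun u => (- (s + t)) * u + (s + t)))).
      move=> u; rewrite inE /= in_itv /= => /andP[u0 uk].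
      by rewrite [RHS]h2// mulNr addrC.
    refine (@within_continuous_comp_within R R E _ `[0, 1]%classic (fun u => - (s + t) * u + (s + t)) g _ _ _).
    * exact/continuous_subspaceT/continuous_affine.
    * exact: arc_cont gB.
    * by move=> u /=; rewrite !in_itv /= mulNr addrC; exact: r2'.
(* The two pieces meet only at the common point, by minimality of [s]. *)
- have key u v : 0 <= u <= k -> k < v <= 1 -> h u = h v -> u = v.
    move=> uk /andP[kv v1]; have /andP[u0 u1] := uk.
    rewrite h1// h2; last exact: ltW.
    move=> fg; have kv1 : k <= v <= 1 by rewrite v1 ltW.
    have gv : subarc g 0 1 (f ((s + t) * u)).
      by rewrite fg; apply/subarcP; eexists; [exact: r2' kv1|].
    have /andP[su0] := r1 _ uk.
    rewrite le_eqVlt => /orP[/eqP su|su]; last by case: (fNg ((s + t) * u)); rewrite ?su0.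
    have t01 : 0 <= t <= 1 by rewrite t0.
    have := arc_inj gB t01 (r2' _ kv1); rewrite gt -fg su => /(_ erefl) => tE.
    have : (s + t) * k < (s + t) * v by rewrite ltr_pM2l.
    by rewrite kE; lra.
  move=> u v; rewrite !itv01E => /andP[u0 u1] /andP[v0 v1].
  case: (leP u k) => uk; case: (leP v k) => vk.
  + rewrite !h1// => /(arc_inj fA) -/(_ (r1' _ _) (r1' _ _)).
    rewrite u0 uk v0 vk => /(_ erefl erefl).
    by apply: mulfI; rewrite gt_eqF.
  + by apply: key; rewrite ?u0 ?vk.
  + by move/esym => huv; apply/esym; apply: key huv; rewrite ?v0 ?uk.
  + rewrite !h2 ?ltW// => /(arc_inj gB) -/(_ (r2' _ _) (r2' _ _)).
    rewrite u1 v1 !ltW// => /(_ erefl erefl) /addrI /oppr_inj.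
    by apply: mulfI; rewrite gt_eqF.
- move=> x /subarcP[u /andP[u0 u1] <-]; case: (leP u k) => uk.
    by left; rewrite h1//; apply: (arc_in fA); apply: r1'; rewrite u0.
  by right; rewrite h2 ?ltW//; apply: (arc_in gB); apply: r2'; rewrite u1 ltW.
- by rewrite h1// mulr0.
- by rewrite h2// mulr1 subrr.
Qed.

End Arcs.

(** * Segments, annuli and joining inside a set *)

Section Joined.
Variables (R : realType) (E : normedModType R).
Implicit Types (A B G : set E) (a b c p u v w x y z : E).

(** Two points of [A] joined by an arc, or equal: arcs are nondegenerate, and
    allowing equality makes the relation an equivalence on [A]. *)
Definition joined A a b :=
  (a = b /\ A a) \/ exists f : R -> E, arc_joining A a b f.

Lemma joined_sub A B a b : A `<=` B -> joined A a b -> joined B a b.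
Proof.
move=> AB [[<- Aa]|[f fA]]; first by left; split=> //; exact: AB.
by right; exists f; exact: arc_sub fA.
Qed.

Lemma joined_sym A a b : joined A a b -> joined A b a.
Proof.
move=> [[<- Aa]|[f fA]]; first by left.
by right; eexists; exact: arc_rev fA.
Qed.

Lemma joined_trans A a b c : joined A a b -> joined A b c -> joined A a c.
Proof.
move=> [[<- //]|[f fA]] [[<- _]|[g gA]]; first by right; exists f.
have [->|ac] := eqVneq a c.
  left; split=> //; have [_ _ _ _ <-] := gA.
  by apply: (arc_in gA); rewrite ler01 lexx.
have [h [hA _]] := arc_splice fA (arc_rev gA) ac.
by right; exists h; rewrite setUid in hA.
Qed.

Lemma joined_subarc A B a b f (s t : R) : arc_joining A a b f ->
  0 <= s -> s <= t -> t <= 1 -> (forall r, s <= r <= t -> B (f r)) ->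
  joined B (f s) (f t).
Proof.
move=> fA s0; rewrite le_eqVlt => /predU1P[<-|st] t1 fB.
  by left; split=> //; apply: fB; rewrite lexx.
right; eexists; apply: (arc_piece fA); [lra|lra|by rewrite lt_eqF|].
by move=> r r01; apply: fB; nra.
Qed.

Lemma continuous_segment a b : continuous (fun t : R => a + t *: (b - a)).
Proof.
move=> t; apply: cvgD; first exact: cvg_cst.
by apply: cvgZr_tmp; exact: cvg_id.
Qed.

Lemma segment_arc A a b : a != b ->
  (forall t : R, 0 <= t <= 1 -> A (a + t *: (b - a))) ->
  arc_joining A a b (fun t => a + t *: (b - a)).
Proof.
move=> ab sA; split.
- exact/continuous_subspaceT/continuous_segment.
- move=> s t _ _ /addrI /eqP; rewrite -subr_eq0 -scalerBl scaler_eq0 !subr_eq0.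
  by rewrite [b == a]eq_sym (negbTE ab) orbF => /eqP.
- by move=> x /subarcP[t t01 <-]; exact: sA.
- by rewrite scale0r addr0.
- by rewrite scale1r addrC subrK.
Qed.

Lemma segment_joined A a b :
  (forall t : R, 0 <= t <= 1 -> A (a + t *: (b - a))) -> joined A a b.
Proof.
have [->|ab] := eqVneq a b => sA.
  by left; split=> //; have := sA 0; rewrite scale0r addr0; apply; rewrite lexx ler01.
by right; eexists; exact: segment_arc ab sA.
Qed.

(** Away from the boundary the open set [G] is also closed, so its trace on [A]
    is open, closed and nonempty. *)
Lemma connected_subset_open (T : topologicalType) (A G : set T) : connected A -> open G ->
  A `&` G !=set0 -> (forall x : T, A x -> ~ boundary G x) -> A `<=` G.
Proof.
move=> Ac Go AG0 AbG.
have AGE : A `&` G = A `&` closure G.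
  apply/seteqP; split=> x [Ax]; first by move=> Gx; split=> //; exact: subset_closure.
  move=> cGx; split=> //; apply: contrapT => Gx; apply: (AbG _ Ax); split=> //.
  by move/interior_id: Go => ->.
have <- : A `&` G = A.
  apply: Ac => //; first by exists G.
  by exists (closure G) => //; exact: closed_closure.
by move=> x [].
Qed.

Lemma segment_connected_set a b :
  connected ((fun t : R => a + t *: (b - a)) @` `[0, 1]).
Proof.
apply: connected_continuous_connected; first exact: segment_connected.
exact/continuous_subspaceT/continuous_segment.
Qed.

Lemma segment_in_open G a b : open G -> G a ->
  (forall t : R, 0 <= t <= 1 -> ~ boundary G (a + t *: (b - a))) ->
  forall t : R, 0 <= t <= 1 -> G (a + t *: (b - a)).
Proof.
move=> Go Ga sG t t01.
apply: (connected_subset_open (@segment_connected_set a b) Go).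
- exists a; split=> //; exists 0; first by rewrite /= in_itv /= lexx ler01.
  by rewrite scale0r addr0.
- by move=> x [s /=]; rewrite in_itv /= => s01 <-; exact: sG.
- by exists t => //=; rewrite in_itv.
Qed.

Lemma segment_crosses_boundary G a b : open G -> G a -> ~ G b ->
  exists2 t : R, 0 <= t <= 1 & boundary G (a + t *: (b - a)).
Proof.
move=> Go Ga Gb; apply: contrapT => nt; apply: Gb.
have -> : b = a + (1 : R) *: (b - a) by rewrite scale1r addrC subrK.
apply: segment_in_open => //; last by rewrite ler01 lexx.
by move=> t t01 tG; apply: nt; exists t.
Qed.

Lemma segmentE a b p (t : R) :
  a + t *: (b - a) - p = (1 - t) *: (a - p) + t *: (b - p).
Proof.
have -> : b - a = (b - p) - (a - p) by rewrite opprB addrA subrK.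
rewrite scalerBr scalerBl scale1r addrAC addrA addrAC.
by rewrite -!addrA; congr (_ + (_ + _)); rewrite addrC.
Qed.

Lemma segment_norm_le a b p (rho t : R) : 0 <= t <= 1 -> `|a - p| <= rho ->
  `|b - p| <= rho -> `|a + t *: (b - a) - p| <= rho.
Proof.
move=> /andP[t0 t1] ap bp; rewrite segmentE.
apply: le_trans (ler_normD _ _) _; rewrite !normrZ (ger0_norm t0) ger0_norm; last lra.
by nra.
Qed.

Lemma dim_ge2_not_line (dimE : dim_ge2 E) u : exists w, forall t : R, w != t *: u.
Proof.
have [e1 [e2 e12]] := dimE.
apply: contrapT => /forallNP nw.
have el w : exists t : R, w = t *: u.
  by have /existsNP[t /negP /negPn /eqP wt] := nw w; exists t.
have [s sE] := el e1; have [t tE] := el e2.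
have [t0 /eqP] : t = 0 /\ - s = 0.
  by apply: e12; rewrite sE tE !scalerA mulNr mulrC scaleNr subrr.
rewrite oppr_eq0 => /eqP s0.
have [/eqP] : (1 : R) = 0 /\ (0 : R) = 0.
  by apply: e12; rewrite sE s0 !scale0r scaler0 addr0.
by rewrite oner_eq0.
Qed.

(** A vector orthogonal to [u] in the sense of Birkhoff: the distance from a
    vector [w0] off the line of [u] to that line is attained, by compactness,
    and the difference with a nearest point is rescaled. *)
Lemma exists_transversal (dimE : dim_ge2 E) u (rho : R) : u != 0 -> 0 < rho ->
  exists w, `|w| = rho /\ forall t : R, rho <= `|w + t *: u|.
Proof.
move=> u0 rho0; have [w0 w0P] := dim_ge2_not_line dimE u.
have nu : 0 < `|u| by rewrite normr_gt0.
pose phi (t : R) := `|w0 - t *: u|.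
(* Outside [-T, T] the points of the line are farther from [w0] than 0 is. *)
pose T := 2 * `|w0| / `|u|.
have T0 : 0 <= T by rewrite /T divr_ge0// mulr_ge0.
have phic : continuous phi.
  move=> t; apply: cvg_norm; apply: cvgB; first exact: cvg_cst.
  by apply: cvgZr_tmp; exact: cvg_id.
have TT : - T <= T by lra.
have [t0 t0T t0P] := EVT_min TT (continuous_subspaceT phic).
set m := phi t0 in t0P.
have m0 : 0 < m by rewrite normr_gt0 subr_eq0 w0P.
have mP t : m <= phi t.
  have [tT|] := boolP (t \in `[- T, T]); first exact: t0P.
  rewrite in_itv /= -ler_norml -ltNge => Tt.
  have : m <= phi 0 by apply: t0P; rewrite in_itv /= oppr_le0 T0.
  rewrite [phi 0]/phi scale0r subr0 => /le_trans; apply.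
  have : T * `|u| <= `|t| * `|u| by rewrite ler_pM2r// ltW.
  rewrite /T divfK ?gt_eqF// -normrZ /phi distrC => h.
  by have := lerB_dist (t *: u) w0; lra.
exists ((rho / m) *: (w0 - t0 *: u)); split.
  by rewrite normrZ gtr0_norm ?divr_gt0// -/(phi t0) -/m divfK// gt_eqF.
move=> t.
have -> : (rho / m) *: (w0 - t0 *: u) + t *: u =
    (rho / m) *: (w0 - (t0 - t * (m / rho)) *: u).
  rewrite [in RHS]scalerBl opprB addrCA addrC [RHS]scalerDr scalerA addrC.
  congr (_ + _ *: _); field; by rewrite !gt_eqF.
rewrite normrZ gtr0_norm ?divr_gt0// -/(phi _).
have : (rho / m) * m <= (rho / m) * phi (t0 - t * (m / rho)).
  by rewrite ler_pM2l ?divr_gt0.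
by rewrite divfK// gt_eqF.
Qed.

(** For small [s] the point is close to [v], of norm [rho]; for larger [s] the
    component along [w] keeps it away from the line of [u], near which [v]
    lies. *)
Lemma segment_avoids u v w (rho lam s : R) : 0 < rho -> `|v| = rho ->
  `|w| = rho -> (forall t : R, rho <= `|w + t *: u|) ->
  `|v - lam *: u| <= rho / 9 -> 0 <= s <= 1 ->
  rho / 20 <= `|(1 - s) *: v + s *: w|.
Proof.
move=> rho0 nv nw wP vl /andP[s0 s1].
case: (leP s (2 / 5)) => s25.
  have := lerB_dist ((1 - s) *: v) (- (s *: w)).
  by rewrite normrN !normrZ nv nw opprK (ger0_norm s0) ger0_norm; nra.
have sw : s * rho <= `|s *: w + ((1 - s) * lam) *: u|.
  have -> : s *: w + ((1 - s) * lam) *: u = s *: (w + ((1 - s) * lam / s) *: u).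
    by rewrite scalerDr scalerA [s * _]mulrC divfK// gt_eqF//; lra.
  by rewrite normrZ ger0_norm// ler_wpM2l.
have -> : (1 - s) *: v + s *: w =
    (s *: w + ((1 - s) * lam) *: u) - (- ((1 - s) *: (v - lam *: u))).
  by rewrite opprK scalerBr scalerA [RHS]addrACA subrr addr0 addrC.
have := lerB_dist (s *: w + ((1 - s) * lam) *: u) (- ((1 - s) *: (v - lam *: u))).
rewrite normrN normrZ ger0_norm; last lra.
by nra.
Qed.

(** If the segment from [a] to [b] comes close to [p], then [b - p] is nearly a
    multiple of [a - p], and both points can be joined by segments to a point
    in a direction transversal to [a - p]. *)
Lemma annulus_joined (dimE : dim_ge2 E) p a b (rho : R) : 0 < rho ->
  `|a - p| = rho -> `|b - p| = rho ->
  joined [set x | rho / 20 <= `|x - p| <= rho] a b.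
Proof.
move=> rho0 ap bp; set A := mkset _.
have segA c d : `|c - p| = rho -> `|d - p| = rho ->
    (forall t : R, 0 <= t <= 1 -> rho / 20 <= `|(1 - t) *: (c - p) + t *: (d - p)|) ->
    joined A c d.
  move=> cp dp cd; apply: segment_joined => t t01; apply/andP; split.
    by rewrite segmentE; exact: cd.
  by apply: segment_norm_le => //; rewrite ?cp ?dp.
have [|/existsNP[t /not_implyP[/andP[t0 t1] /negP]]] := pselect (forall t : R, 0 <= t <= 1 ->
  rho / 20 <= `|(1 - t) *: (a - p) + t *: (b - p)|); first exact: segA.
rewrite -ltNge; set q := _ + _ => qlt.
have ap0 : a - p != 0 by rewrite -normr_gt0 ap.
have [w [nw wP]] := exists_transversal dimE ap0 rho0.
have wp : `|w + p - p| = rho by rewrite addrK.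
apply: (@joined_trans _ _ (w + p)); [|apply: joined_sym]; apply: segA => // s s01; rewrite addrK;
  [apply: (@segment_avoids (a - p) _ _ _ 1) => //|
   apply: (@segment_avoids (a - p) _ _ _ (- (1 - t) / t)) => //].
  by rewrite scale1r subrr normr0; lra.
(* [q] is short while [a - p] and [b - p] have the same norm, so [t] is near 1/2. *)
have tbig : 19 / 40 <= t.
  have := lerB_dist ((1 - t) *: (a - p)) (- (t *: (b - p))).
  rewrite opprK normrN !normrZ ap bp -/q (ger0_norm t0) ger0_norm; last lra.
  by nra.
have t00 : 0 < t by lra.
have -> : b - p - (- (1 - t) / t) *: (a - p) = t^-1 *: q.
  rewrite /q [RHS]scalerDr !scalerA mulVf ?gt_eqF// scale1r addrC; congr (_ + _).
  by rewrite -scaleNr; congr (_ *: _); field; rewrite gt_eqF.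
rewrite normrZ gtr0_norm ?invr_gt0// mulrC ler_pdivrMr//.
by nra.
Qed.

End Joined.

(** * Uniformity conditions in terms of cross ratios *)

Section Conditions.
Variables (R : realType) (E : normedModType R).
Implicit Types (G : set E) (a b x y z : E) (c C : R).

(** The inequalities say that the cross ratios of (x, y, x1, x2) and of
    (x, y, x2, x1) are at most [C]; in product form they make sense for [x]
    equal to [x1] or [x2]. *)
Definition moebius_region C G x1 x2 : set E :=
  [set x | G x /\ forall y, boundary G y ->
     `|x - x1| * `|x2 - y| <= C * `|x - y| * `|x1 - x2| /\
     `|x - x2| * `|x1 - y| <= C * `|x - y| * `|x1 - x2|].

(** The limit of the inequalities of [moebius_region] when [y] tends to
    infinity. *)
Definition bounded_region C x1 x2 : set E :=
  [set x | `|x - x1| <= C * `|x1 - x2| /\ `|x - x2| <= C * `|x1 - x2|].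

Definition moebius_uniform C G := forall x1 x2, G x1 -> G x2 -> x1 != x2 ->
  exists f : R -> E, arc_joining (moebius_region C G x1 x2) x1 x2 f.

Definition bounded_moebius_uniform C G := forall x1 x2, G x1 -> G x2 ->
  x1 != x2 -> exists f : R -> E,
  arc_joining (moebius_region C G x1 x2 `&` bounded_region C x1 x2) x1 x2 f.

Lemma moebius_region_sym C G x1 x2 x :
  moebius_region C G x1 x2 x -> moebius_region C G x2 x1 x.
Proof.
move=> [Gx xP]; split=> // y /xP[h1 h2].
by rewrite (distrC x2 x1); split.
Qed.

Lemma boundary_not_in G y : open G -> boundary G y -> ~ G y.
Proof. by move=> /interior_id Go [_]; rewrite Go. Qed.

Lemma subarc_diam f (s t : R) x y : subarc f s t x -> subarc f s t y ->
  (`|x - y|%:E <= diam (subarc f s t : set E))%E.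
Proof. by move=> sx sy; apply: ereal_sup_ubound; exists x, y. Qed.

Lemma dist_boundary_le G x y : boundary G y ->
  (dist_boundary G x <= `|x - y|%:E)%E.
Proof. by move=> Gy; apply: ereal_inf_lbound; exists y. Qed.

(** With d = |x - y|, one of |x - x1| and |x - x2| is at most c d, and both are
    at most c |x1 - x2|; the distances from [y] to the endpoints are then
    estimated by the triangle inequality. *)
Lemma diameter_bounded_moebius c G : 1 <= c -> diameter_uniform c G ->
  bounded_moebius_uniform (c * (c + 2)) G.
Proof.
move=> c1 Gc x1 x2 Gx1 Gx2 x12; have [f [fG fdiam fcig]] := Gc _ _ Gx1 Gx2 x12.
exists f; apply: (arc_restr _ fG) => t t01.
have [_ _ _ f0 f1] := fG.
set r := `|x1 - x2| in fdiam *.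
have r0 : 0 <= r by exact: normr_ge0.
have fs s u v : u <= s <= v -> subarc f u v (f s) by move=> suv; apply/subarcP; exists s.
have dr s : 0 <= s <= 1 -> `|f t - f s| <= c * r.
  move=> s01; rewrite -lee_fin; apply: le_trans fdiam.
  by apply: subarc_diam; exact: fs.
have X1 : `|f t - x1| <= c * r by rewrite -f0; apply: dr; rewrite lexx ler01.
have X2 : `|f t - x2| <= c * r by rewrite -f1; apply: dr; rewrite lexx ler01.
have ccr : c * r <= c * (c + 2) * r by rewrite ler_wpM2r//; nra.
split; last by split; [exact: le_trans X1 ccr|exact: le_trans X2 ccr].
split=> [|y yG]; first exact: (arc_in fG).
have X12 : (`|f t - x1| <= c * `|f t - y|) || (`|f t - x2| <= c * `|f t - y|).
  have /andP[t0 t1] := t01.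
  have : (c%:E * dist_boundary G (f t) <= (c * `|f t - y|)%:E)%E.
    by rewrite EFinM lee_wpmul2l ?lee_fin ?dist_boundary_le//; lra.
  move=> /(le_trans (fcig _ t01)); rewrite ge_min => /orP[|] /(le_trans _) h.
    apply/orP; left; rewrite -lee_fin; apply: h; rewrite -f0.
    by apply: subarc_diam; apply: fs; rewrite ?lexx ?t0.
  apply/orP; right; rewrite -lee_fin; apply: h; rewrite -f1.
  by apply: subarc_diam; apply: fs; rewrite ?lexx ?t1.
have Y1 : `|x1 - y| <= `|f t - x1| + `|f t - y|.
  by rewrite (distrC (f t) x1); exact: ler_distD.
have Y2 : `|x2 - y| <= `|f t - x2| + `|f t - y|.
  by rewrite (distrC (f t) x2); exact: ler_distD.
have Y12 : `|x2 - y| <= r + `|x1 - y| by rewrite /r (distrC x1 x2); exact: ler_distD.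
have Y21 : `|x1 - y| <= r + `|x2 - y| by exact: ler_distD.
move: X1 X2 X12 Y1 Y2 Y12 Y21.
move: (normr_ge0 (f t - x1)) (normr_ge0 (f t - x2)) (normr_ge0 (f t - y)).
move: `|f t - x1| `|f t - x2| `|f t - y| `|x1 - y| `|x2 - y| => A B D Y Y'.
move=> A0 B0 D0 Acr Bcr ABD Y1 Y2 Y12 Y21.
have [Dr AD BD AcD] : [/\ 0 <= D * r, A * D <= c * r * D, B * D <= c * r * D & 0 <= c * (D * r)].
  by split; [exact: mulr_ge0|exact: ler_wpM2r|exact: ler_wpM2r|rewrite !mulr_ge0//; lra].
rewrite -/r; case/orP: ABD => h.
  have Ar : A * r <= c * D * r by exact: ler_wpM2r.
  have h1 : A * Y' <= A * (r + (A + D)) by apply: ler_wpM2l => //; lra.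
  have h2 : A * A <= (c * r) * (c * D) by exact: ler_pM.
  have h3 : B * Y <= B * (c * D + D) by apply: ler_wpM2l => //; lra.
  have h4 : B * (c * D) <= (c * r) * (c * D) by apply: ler_wpM2r; [apply: mulr_ge0 => //; lra|].
  by split; lra.
have Br : B * r <= c * D * r by exact: ler_wpM2r.
have h1 : B * Y <= B * (r + (B + D)) by apply: ler_wpM2l => //; lra.
have h2 : B * B <= (c * r) * (c * D) by exact: ler_pM.
have h3 : A * Y' <= A * (c * D + D) by apply: ler_wpM2l => //; lra.
have h4 : A * (c * D) <= (c * r) * (c * D) by apply: ler_wpM2r; [apply: mulr_ge0 => //; lra|].
by split; lra.
Qed.

Lemma delta_moebius (delta : R) G : open G -> 0 < delta < 1 ->
  delta_uniform delta G -> moebius_uniform delta^-1 G.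
Proof.
move=> Go /andP[d0 d1] Gd x1 x2 Gx1 Gx2 x12; have [f [fG fP]] := Gd _ _ Gx1 Gx2 x12.
exists f; apply: (arc_restr _ fG) => t t01.
have ft : subarc f 0 1 (f t) by apply/subarcP; exists t.
have Gft : G (f t) by exact: (arc_in fG).
split=> // y /(boundary_not_in Go) Gy.
have ne z : G z -> 0 < `|z - y|.
  by move=> Gz; rewrite normr_gt0 subr_eq0; apply/eqP => zy; apply: Gy; rewrite -zy.
have r0 : 0 < `|x1 - x2| by rewrite normr_gt0 subr_eq0.
have key a b : 0 < `|b - y| -> 0 < `|f t - a| ->
    delta <= `|f t - y| / `|f t - a| * (`|x1 - x2| / `|b - y|) ->
    `|f t - a| * `|b - y| <= delta^-1 * `|f t - y| * `|x1 - x2|.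
  move=> by0 fa0; rewrite mulrACA -invfM ler_pdivlMr ?mulr_gt0// => h.
  by rewrite -mulrA [_^-1 * _]mulrC ler_pdivlMr// mulrC.
have d1' : 1 <= delta^-1 by rewrite -invr1 lef_pV2 ?posrE ?ltr01// ltW.
have endp a : 0 <= delta^-1 * `|a - y| * `|x1 - x2|.
  by rewrite !mulr_ge0// invr_ge0 ltW.
have endp' a : `|x1 - x2| * `|a - y| <= delta^-1 * `|a - y| * `|x1 - x2|.
  by rewrite -mulrA mulrC ler_peMl// mulr_ge0.
have [->|n1] := eqVneq (f t) x1; first by rewrite subrr normr0 mul0r.
have [->|n2] := eqVneq (f t) x2; first by rewrite subrr normr0 mul0r distrC.
have [h1 h2] := fP _ _ ft n1 n2 Gy.
split; apply: key; rewrite ?normr_gt0 ?subr_eq0//; first by rewrite -subr_eq0 -normr_gt0 ne.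
  by rewrite -subr_eq0 -normr_gt0 ne.
by rewrite [`|x1 - x2|]distrC.
Qed.

(** For [y] outside [G] the inequality holds at the boundary point [z] of the
    segment from [x] to [y]; since |z - y| <= |x - y|, replacing [z] by [y] costs
    at most |x - xi| |x - y|, which the condition at infinity absorbs. *)
Lemma bounded_moebius_delta C G : open G -> 1 <= C ->
  bounded_moebius_uniform C G -> delta_uniform (2 * C)^-1 G.
Proof.
move=> Go C1 GC x1 x2 Gx1 Gx2 x12; have [f fA] := GC _ _ Gx1 Gx2 x12.
exists f; split; first by apply: (arc_restr _ fA) => t t01; have [[]] := arc_in fA t01.
move=> x y /subarcP[t t01 <-{x}] n1 n2 Gy.
have [[Gx xP] [X1 X2]] := arc_in fA t01.
have ne z : G z -> 0 < `|z - y|.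
  by move=> Gz; rewrite normr_gt0 subr_eq0; apply/eqP => zy; apply: Gy; rewrite -zy.
have r0 : 0 < `|x1 - x2| by rewrite normr_gt0 subr_eq0.
have key a b : G b -> 0 < `|f t - a| -> `|f t - a| <= C * `|x1 - x2| ->
    (forall z, boundary G z -> `|f t - a| * `|b - z| <= C * `|f t - z| * `|x1 - x2|) ->
    (2 * C)^-1 <= `|f t - y| / `|f t - a| * (`|x1 - x2| / `|b - y|).
  move=> Gb fa0 fa bP; have := ne _ Gb => by0.
  rewrite mulrACA -invfM ler_pdivlMr ?mulr_gt0// mulrC.
  rewrite ler_pdivrMr; last lra.
  have [s /andP[s0 s1] sG] := segment_crosses_boundary Go Gx Gy.
  have := bP _ sG; set z := f t + s *: (y - f t) => bz.
  have z1 : `|f t - z| <= `|f t - y|.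
    rewrite /z opprD addrA subrr sub0r normrN normrZ ger0_norm// distrC.
    by rewrite ler_piMl.
  have z2 : `|z - y| <= `|f t - y|.
    rewrite /z segmentE subrr scaler0 addr0 normrZ ger0_norm; last lra.
    by rewrite ler_piMl//; lra.
  have z3 := ler_distD z b y.
  have h1 : `|f t - a| * `|b - y| <= `|f t - a| * (`|b - z| + `|f t - y|).
    by apply: ler_wpM2l => //; lra.
  have h2 : `|f t - a| * `|f t - y| <= C * `|x1 - x2| * `|f t - y|.
    exact: ler_wpM2r.
  have h3 : C * `|f t - z| * `|x1 - x2| <= C * `|f t - y| * `|x1 - x2|.
    by apply: ler_wpM2r => //; apply: ler_wpM2l => //; lra.
  by nra.
split; [|rewrite (distrC x2 x1)]; apply: key => //.
- by rewrite normr_gt0 subr_eq0.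
- by move=> z /xP[].
- by rewrite normr_gt0 subr_eq0.
- by move=> z /xP[].
Qed.

End Conditions.

(** * Bounding the arcs *)

Section Bounded.
Variables (R : realType) (E : normedModType R).
Implicit Types (A G : set E) (a b p x y z : E) (c C : R) (f : R -> E).

Lemma continuous_dist f p : {within `[0, 1], continuous f} ->
  {within `[0, 1], continuous (fun t => `|f t - p|)}.
Proof.
move=> fc; apply/within_normP => t t01 e e0.
have [d d0 dP] := (within_normP _ _).1 fc _ t01 _ e0.
exists d => // s s01 ts; apply: le_lt_trans (dP _ s01 ts).
by apply: le_trans (ler_dist_dist _ _) _; rewrite opprB addrA subrK.
Qed.

Lemma arc_first_exit f p (rho t0 : R) : {within `[0, 1], continuous f} ->
  0 <= t0 <= 1 -> `|f 0 - p| <= rho -> rho <= `|f t0 - p| ->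
  exists s, [/\ 0 <= s <= t0, `|f s - p| = rho &
    forall u, 0 <= u <= s -> `|f u - p| <= rho].
Proof.
move=> fc t01 f0 ft0.
have Kc : closed [set z : E | rho <= `|z - p|].
  apply: (@closed_comp _ _ (fun z : E => `|z - p|) [set t : R | rho <= t]).
    by move=> z _; apply: cvg_norm; apply: cvgB; [exact: cvg_id|exact: cvg_cst].
  exact: closed_ge.
have [s [/andP[s0 st] /= Ks nK]] := arc_first_hit fc Kc t01 ft0.
have lt u : 0 <= u < s -> `|f u - p| <= rho.
  by move=> /nK /negP; rewrite -ltNge => /ltW.
have fcs : {within `[0, s], continuous (fun t => `|f t - p|)}.
  apply: continuous_subspaceW (continuous_dist (p := p) fc) => u /=.
  by rewrite !in_itv /=; lra.
have [|c] := @IVT _ _ 0 s rho s0 fcs.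
  by rewrite ge_min f0 le_max Ks orbT.
rewrite in_itv /= => /andP[c0]; rewrite le_eqVlt => /orP[/eqP ->|cs] /= fcE; last first.
  by case: (nK c); rewrite ?c0 //= fcE.
exists s; split=> //; first by rewrite s0.
move=> u /andP[u0]; rewrite le_eqVlt => /orP[/eqP -> |us]; first by rewrite fcE.
by apply: lt; rewrite u0.
Qed.

Lemma joined_in_open A G a b : open G -> G a -> joined A a b ->
  (forall x, A x -> ~ boundary G x) -> joined (A `&` G) a b.
Proof.
move=> Go Ga [[<- Aa] _|[f fA] AG]; first by left.
right; exists f; apply: (arc_restr _ fA) => t t01; split; first exact: arc_in fA _.
have fc : connected (f @` `[0, 1]).
  apply: connected_continuous_connected; first exact: segment_connected.
  exact: arc_cont fA.
apply: (connected_subset_open fc Go); last by exists t; rewrite //= in_itv.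
  have [_ _ _ f0 _] := fA.
  by exists a; split=> //; exists 0; rewrite //= in_itv /= lexx ler01.
by move=> x [s /=]; rewrite in_itv /= => s01 <-; apply: AG; exact: arc_in fA _.
Qed.

Lemma moebius_region_le C C' G x1 x2 : C <= C' ->
  moebius_region C G x1 x2 `<=` moebius_region C' G x1 x2.
Proof.
move=> CC x [Gx xP]; split=> // y /xP[h1 h2].
have h : C * `|x - y| * `|x1 - x2| <= C' * `|x - y| * `|x1 - x2|.
  by do 2 apply: ler_wpM2r => //.
by split; [exact: le_trans h1 h|exact: le_trans h2 h].
Qed.

(** Insert |x - y| <= |x - x1| + |x1 - x2| + |x2 - y| in the inequality for
    |x - x1| |x2 - y|: as |x - x1| is much larger than C |x1 - x2|, the term
    with |x2 - y| can be absorbed on the left. *)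
Lemma excursion_boundary_near C G x1 x2 x y : 1 <= C ->
  moebius_region C G x1 x2 x -> 200 * C * `|x1 - x2| < `|x - x2| ->
  boundary G y -> `|x2 - y| <= 4 * C * `|x1 - x2|.
Proof.
move=> C1 [_ xP] far /xP[h _].
have t1 := ler_distD x2 x y; have t2 := ler_distD x1 x x2.
set r := `|x1 - x2| in far h t2 *.
have r0 : 0 <= r by exact: normr_ge0.
have Cr : r <= C * r by rewrite ler_peMl.
move: t1 t2 far h (normr_ge0 (x2 - y)).
move: `|x2 - y| `|x - x1| `|x - x2| `|x - y| => Y X1 X2 D t1 t2 far h Y0.
have k0 : 0 <= C * r by lra.
have h1 : C * D * r <= C * r * (X1 + r + Y) by rewrite mulrAC; apply: ler_wpM2l => //; lra.
rewrite leNgt; apply/negP => hlt.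
have h2 : 0 < (Y - 4 * C * r) * (X1 - C * r) by apply: mulr_gt0; lra.
have h3 : 0 <= (C * r) * (X1 - 199 * (C * r)) by apply: mulr_ge0; lra.
have h4 : 0 <= (C * r) * (C * r - r) by apply: mulr_ge0; lra.
have h5 : 0 <= (C * r) * (C * r) by exact: mulr_ge0.
by lra.
Qed.

(** If the arc leaves the ball about [x2] of radius 200 C |x1 - x2|, it is kept
    up to its first exit and after its last exit, and the two exit points are
    joined in an annulus of inner radius 10 C |x1 - x2|; the boundary lies
    within 4 C |x1 - x2| of [x2], so the annulus is in [G], and its points are
    far from the boundary at the scale |x1 - x2|. *)
Lemma moebius_bounded C G : dim_ge2 E -> open G -> 1 <= C ->
  moebius_uniform C G -> bounded_moebius_uniform (201 * C) G.
Proof.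
move=> dimE Go C1 GC x1 x2 Gx1 Gx2 x12.
have [f fA] := GC _ _ Gx1 Gx2 x12.
set r := `|x1 - x2|; have r0 : 0 < r by rewrite /r normr_gt0 subr_eq0.
have Cr : r <= C * r by rewrite ler_peMl// ltW.
pose rho := 200 * (C * r); have rho0 : 0 < rho by rewrite /rho; lra.
set A := _ `&` _.
have inner t : 0 <= t <= 1 -> `|f t - x2| <= rho -> A (f t).
  move=> t01 ft; split.
    by apply: (moebius_region_le (C := C)); [lra|exact: arc_in fA t01].
  have := ler_distD x2 (f t) x1; rewrite [`|x2 - x1|]distrC -/r => tr.
  by split; rewrite -/r; move: ft tr; rewrite /rho; lra.
have [fin|/existsNP[t /not_implyP[t01 /negP]]] :=
  pselect (forall t, 0 <= t <= 1 -> `|f t - x2| <= rho).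
  by exists f; apply: (arc_restr _ fA) => t t01; apply: inner => //; exact: fin.
rewrite -ltNge => ft.
have bG y : boundary G y -> `|x2 - y| <= 4 * (C * r).
  rewrite mulrA; apply: excursion_boundary_near (arc_in fA t01) _ => //.
  by rewrite -mulrA.
have [_ _ _ f0 f1] := fA.
have fc := arc_cont fA.
have [s [s0t fs sin]] : exists s, [/\ 0 <= s <= t, `|f s - x2| = rho &
    forall u, 0 <= u <= s -> `|f u - x2| <= rho].
  apply: arc_first_exit => //; last exact: ltW.
  by rewrite f0 -/r /rho; lra.
have [s' [s0t' fs' sin']] : exists s, [/\ 0 <= s <= 1 - t, `|f (1 - s) - x2| = rho &
    forall u, 0 <= u <= s -> `|f (1 - u) - x2| <= rho].
  apply: (@arc_first_exit (fun u => f (1 - u))).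
  - exact: arc_cont (arc_rev fA).
  - lra.
  - by rewrite subr0 f1 subrr normr0 ltW.
  - by rewrite subKr ltW.
have xs : joined A x1 (f s).
  rewrite -f0; apply: joined_subarc fA _ _ _ _; [lra|lra|lra|].
  by move=> u us; apply: inner; [lra|exact: sin].
have xs' : joined A (f (1 - s')) x2.
  rewrite -f1; apply: joined_subarc fA _ _ _ _; [lra|lra|lra|].
  move=> u us; apply: inner; first lra.
  by have := sin' (1 - u); rewrite subKr; apply; lra.
have ann : joined A (f s) (f (1 - s')).
  have Gfs : G (f s) by have [] := arc_in fA (t := s); [lra|].
  have := joined_in_open Go Gfs (annulus_joined dimE rho0 fs fs').
  move=> h; apply: joined_sub (h _) => [x [/andP[x1' x2'] Gx]|x /andP[x1' x2'] /bG].
    have trx := ler_distD x2 x x1; rewrite [`|x2 - x1|]distrC -/r in trx.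
    split; last by split; rewrite -/r; move: x2' trx; rewrite /rho; lra.
    split=> // y yG; have := bG _ yG; rewrite -/r => x2y.
    have tr2 := ler_distD y x x2; rewrite [`|y - x2|]distrC in tr2.
    have tr1 := ler_distD x2 x1 y; rewrite -/r in tr1.
    have k0 : 0 <= C * r by lra.
    have -> : 201 * C * `|x - y| * r = (201 * (C * r)) * `|x - y| by ring.
    have D6 : 201 * (C * r) * (6 * (C * r)) <= 201 * (C * r) * `|x - y|.
      by apply: ler_wpM2l; [|move: x1' tr2 x2y; rewrite /rho]; lra.
    split; apply: le_trans D6.
      by apply: ler_pM => //; move: x2' trx x2y; rewrite /rho; lra.
    apply: (@le_trans _ _ (200 * (C * r) * (5 * (C * r)))); last by nra.
    by apply: ler_pM => //; move: x2' tr1 x2y; rewrite /rho; lra.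
  by have := ler_distD x x2 x; rewrite distrC; move: x1'; rewrite /rho; lra.
have [[/eqP]|//] := joined_trans (joined_trans xs ann) xs'.
by rewrite (negbTE x12).
Qed.

End Bounded.

(** * Transfer by a quasimoebius homeomorphism *)

(** Local boundedness of [theta] is the only quantitative input: a bound on a
    cross ratio in [G] gives one in [G'], and applied to the inverse cross
    ratio it shows that small cross ratios in [G'] come from small ones. *)
Lemma homeomorphism_bounded (R : realType) (theta : R -> R) (T : R) :
  homeomorphism_onto [set t : R | 0 <= t] [set t : R | 0 <= t] theta -> 0 <= T ->
  exists M, 1 <= M /\ forall t, 0 <= t <= T -> theta t <= M.
Proof.
move=> [g [[thc _] _ _ _ _]] T0.
have thT : {within `[0, T], continuous theta}.
  by apply: continuous_subspaceW thc => t /=; rewrite in_itv /= => /andP[].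
have [t0 _ t0P] := EVT_max T0 thT.
exists (Order.max 1 (theta t0)); split; first by rewrite le_max lexx.
by move=> t tT; rewrite le_max t0P ?orbT// in_itv.
Qed.

Section Transfer.
Variables (R : realType) (E E' : completeNormedModType R).
Variables (theta : R -> R) (G : set E) (G' : set E') (f : E -> E') (g : E' -> E).
Hypothesis theta_bounded : forall T, 0 <= T ->
  exists M, 1 <= M /\ forall t, 0 <= t <= T -> theta t <= M.
Hypotheses (Go : open G) (G'o : open G').
Hypothesis fc : {within G, continuous f}.
Hypothesis fG : forall x, G x -> G' (f x).
Hypothesis gG : forall y, G' y -> G (g y).
Hypothesis fK : forall x, G x -> g (f x) = x.
Hypothesis gK : forall y, G' y -> f (g y) = y.
Hypothesis fqm : quasimobius theta G f.

Lemma homeo_inj x y : G x -> G y -> f x = f y -> x = y.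
Proof. by move=> Gx Gy fxy; rewrite -(fK Gx) fxy fK. Qed.

(** The product form extends the inequality to coinciding points: either a
    factor on the left vanishes, or both cross ratios are equal to 1. *)
Lemma quasimobius_bound (T M : R) x y z w :
  1 <= M -> (forall t, 0 <= t <= T -> theta t <= M) ->
  G x -> G y -> G z -> G w ->
  `|x - z| * `|y - w| <= T * `|x - y| * `|z - w| ->
  `|f x - f z| * `|f y - f w| <= M * `|f x - f y| * `|f z - f w|.
Proof.
move=> M1 MT Gx Gy Gz Gw h.
have M0 : 0 <= M by lra.
have RHS0 : 0 <= M * `|f x - f y| * `|f z - f w| by rewrite !mulr_ge0.
have [xz|xz] := eqVneq x z; first by move: RHS0; rewrite xz subrr normr0 mul0r.
have [yw|yw] := eqVneq y w; first by move: RHS0; rewrite yw subrr normr0 mulr0.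
have pos (a b : E) : a != b -> 0 < `|a - b| by move=> ab; rewrite normr_gt0 subr_eq0.
have lpos : 0 < `|x - z| * `|y - w| by rewrite mulr_gt0 ?pos.
have [xy|xy] := eqVneq x y; first by move: lpos h; rewrite xy subrr normr0 mulr0 mul0r ltNge => /negbTE ->.
have [zw|zw] := eqVneq z w; first by move: lpos h; rewrite zw subrr normr0 mulr0 ltNge => /negbTE ->.
have [xw|xw] := eqVneq x w.
  by rewrite xw mulrC (distrC (f y)) (distrC (f w) (f z)) -mulrA ler_peMl//.
have [yz|yz] := eqVneq y z.
  by rewrite yz -mulrA ler_peMl// mulr_ge0.
have npos a b : G a -> G b -> a != b -> 0 < `|f a - f b|.
  move=> Ga Gb ab; rewrite normr_gt0 subr_eq0; apply: contra ab => /eqP fab.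
  by apply/eqP; exact: homeo_inj.
have U : uniq [:: x; y; z; w] by rewrite /= !inE !negb_or xy xz xw yz yw zw.
have := fqm Gx Gy Gz Gw U; rewrite /cross_ratio.
have cr : 0 <= `|x - z| / `|x - y| * (`|y - w| / `|z - w|) <= T.
  rewrite mulr_ge0 ?divr_ge0//= mulrACA -invfM ler_pdivrMr ?mulr_gt0 ?pos//.
  by rewrite mulrA.
move=> /le_trans /(_ (MT _ cr)).
by rewrite mulrACA -invfM ler_pdivrMr ?mulr_gt0 ?npos// mulrA.
Qed.

Lemma boundary_approx y' (e : R) : boundary G' y' -> 0 < e ->
  exists2 z, G z & `|f z - y'| < e.
Proof.
move=> [cy _] e0; have [p [G'p]] := cy _ (nbhsx_ballx y' _ e0).
rewrite -ball_normE /= => yp; exists (g p); first exact: gG.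
by rewrite gK// distrC.
Qed.

(** If [y] were in [G], then [f y] would be the limit [y'], which is not in
    [G']. *)
Lemma limit_in_boundary y y' : boundary G' y' ->
  (forall e, 0 < e -> exists z, [/\ G z, `|z - y| < e & `|f z - y'| < e]) ->
  boundary G y.
Proof.
move=> bG' near; split.
  move=> B /nbhs_ballP[e /= e0 eB]; have [z [Gz zy _]] := near _ e0.
  by exists z; split=> //; apply: eB; rewrite -ball_normE /= distrC.
move: (Go) => /interior_id -> Gy; apply: (boundary_not_in G'o bG').
suff -> : y' = f y by exact: fG.
apply/eqP; rewrite -subr_eq0 -normr_eq0; apply: contraT => n0.
have e0 : 0 < `|y' - f y| / 2 by rewrite divr_gt0// lt_def n0 normr_ge0.
have [d d0 dP] := (within_normP _ _).1 fc _ Gy _ e0.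
have [|z [Gz zy fz]] := near (Order.min d (`|y' - f y| / 2)).
  by rewrite lt_min d0.
move: zy fz; rewrite !lt_min => /andP[zd _] /andP[_ fz].
have := dP _ Gz; rewrite distrC => /(_ zd) fyz.
have := ler_distD (f z) y' (f y).
by rewrite (distrC y' (f z)) (distrC (f z) (f y)); lra.
Qed.

(** Compare with two fixed points [a] and [b].  If |z - w| >= eta with [z] and
    [w] bounded, then |z - a| |w - b| is at most a constant times
    |z - w| |a - b|; the corresponding inequality in [G'] bounds |f z - f w|
    from below. *)
Lemma near_boundary_cauchy a b y' (K eta : R) : G a -> G b -> a != b ->
  boundary G' y' -> 0 < eta -> exists2 e, 0 < e &
  forall z w, G z -> G w -> `|z| <= K -> `|w| <= K ->
    `|f z - y'| < e -> `|f w - y'| < e -> `|z - w| < eta.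
Proof.
move=> Ga Gb ab bG' eta0.
have nab : 0 < `|a - b| by rewrite normr_gt0 subr_eq0.
pose T := (`|K| + `|a|) * (`|K| + `|b|) / (eta * `|a - b|).
have T0 : 0 <= T by rewrite /T divr_ge0 ?mulr_ge0 ?addr_ge0// ltW.
have [M [M1 MT]] := theta_bounded T0.
have pos x : G x -> 0 < `|f x - y'|.
  move=> Gx; rewrite normr_gt0 subr_eq0; apply/eqP => fxy.
  by apply: (boundary_not_in G'o bG'); rewrite -fxy; exact: fG.
have nab' : 0 < `|f a - f b|.
  rewrite normr_gt0 subr_eq0; apply: contra ab => /eqP fab.
  by apply/eqP; exact: homeo_inj.
pose D := Order.min `|f a - y'| `|f b - y'| / 2.
have D0 : 0 < D by rewrite /D divr_gt0// lt_min !pos.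
have Da : 2 * D <= `|f a - y'| by rewrite /D mulrC divfK// ge_min lexx.
have Db : 2 * D <= `|f b - y'| by rewrite /D mulrC divfK// ge_min lexx orbT.
pose e := Order.min D (D * D / (2 * M * `|f a - f b|)).
have M0 : 0 < M by lra.
have q0 : 0 < 2 * M * `|f a - f b| by rewrite !mulr_gt0.
have e0 : 0 < e by rewrite /e lt_min D0 divr_gt0// mulr_gt0.
have eD : e <= D by rewrite /e ge_min lexx.
have eq : e * (2 * M * `|f a - f b|) <= D * D.
  by rewrite -ler_pdivlMr// /e ge_min lexx orbT.
exists e => // z w Gz Gw zK wK zy wy; rewrite ltNge; apply/negP => zw.
have zK' : `|z| <= `|K| by apply: le_trans zK (ler_norm _).
have wK' : `|w| <= `|K| by apply: le_trans wK (ler_norm _).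
have za : `|z - a| <= `|K| + `|a| by apply: le_trans (ler_normB _ _) _; rewrite lerD.
have wb : `|w - b| <= `|K| + `|b| by apply: le_trans (ler_normB _ _) _; rewrite lerD.
have : `|z - a| * `|w - b| <= T * `|z - w| * `|a - b|.
  apply: (@le_trans _ _ (T * eta * `|a - b|)).
    by rewrite -mulrA /T divfK ?gt_eqF ?mulr_gt0//; exact: ler_pM.
  by apply: ler_wpM2r => //; apply: ler_wpM2l.
move=> /(quasimobius_bound M1 MT Gz Gw Ga Gb) h.
have fza : D <= `|f z - f a|.
  by have := ler_distD (f z) (f a) y'; rewrite (distrC (f a) (f z)); lra.
have fwb : D <= `|f w - f b|.
  by have := ler_distD (f w) (f b) y'; rewrite (distrC (f b) (f w)); lra.
have fzw : `|f z - f w| < 2 * e.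
  by have := ler_distD y' (f z) (f w); rewrite (distrC y' (f w)); lra.
have h1 : D * D <= `|f z - f a| * `|f w - f b| by apply: ler_pM => //; exact: ltW.
have h2 : `|f z - f w| * (M * `|f a - f b|) < 2 * e * (M * `|f a - f b|).
  by rewrite ltr_pM2r ?mulr_gt0.
by lra.
Qed.

(** The boundary behaviour of [f] as far as it is needed: a boundary point [y']
    corresponds to a boundary point of [G] or to infinity. *)
Lemma boundary_preimage a b y' : G a -> G b -> a != b -> boundary G' y' ->
  (exists2 y, boundary G y &
    forall e, 0 < e -> exists z, [/\ G z, `|z - y| < e & `|f z - y'| < e]) \/
  (forall e K, 0 < e -> exists z, [/\ G z, K < `|z| & `|f z - y'| < e]).
Proof.
move=> Ga Gb ab bG'.
(* Otherwise preimages of points near [y'] are bounded, hence form a Cauchy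
   sequence. *)
have [inf|/existsNP[e0 /existsNP[K /not_implyP[e00 nz]]]] := pselect (forall e K : R,
  0 < e -> exists z, [/\ G z, K < `|z| & `|f z - y'| < e]); first by right.
left.
have zK z : G z -> `|f z - y'| < e0 -> `|z| <= K.
  by move=> Gz fz; rewrite leNgt; apply/negP => Kz; apply: nz; exists z.
have /choice[u uP] (n : nat) : exists z, G z /\ `|f z - y'| < Order.min e0 n.+1%:R^-1.
  have [|z Gz zn] := boundary_approx bG' (e := Order.min e0 n.+1%:R^-1).
    by rewrite lt_min e00 invr_gt0 ltr0n.
  by exists z.
have small (e : R) : 0 < e -> exists N, forall n, (N <= n)%N -> `|f (u n) - y'| < e.
  move=> e1; have := near_infty_natSinv_lt (PosNum e1) => -[N _ NP].
  exists N => n Nn; have [_] := uP n; rewrite lt_min => /andP[_ /lt_trans]; apply.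
  exact: (NP n Nn).
have uK n : `|u n| <= K.
  by have [Gu] := uP n; rewrite lt_min => /andP[fu _]; exact: zK.
have /cauchy_cvgP : cauchy (u @ \oo).
  apply: cauchy_exP => eta /= eta0.
  have [e e1 eP] := near_boundary_cauchy K Ga Gb ab bG' eta0.
  have [N NP] := small _ e1; exists (u N).
  exists N => // n /= Nn; rewrite -ball_normE /=.
  by apply: eP; rewrite ?uK ?NP//; have [] := uP N; have [] := uP n.
move=> /cvg_ex[y uy].
have near e : 0 < e -> exists z, [/\ G z, `|z - y| < e & `|f z - y'| < e].
  move=> e1; have [N NP] := small _ e1.
  have /cvgrPdist_lt /(_ _ e1) [N' _ N'P] := uy.
  exists (u (maxn N N')); split; first by have [] := uP (maxn N N').
    by rewrite distrC; apply: N'P; exact: leq_maxr.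
  by apply: NP; exact: leq_maxl.
by exists y => //; exact: limit_in_boundary bG' near.
Qed.

(** The inequality for [y'] is the limit of those for f z; in [G] the points [z]
    satisfy it with constant 2 C, by continuity when they tend to a boundary
    point, and from |x - a| <= C |a - b| when they tend to infinity. *)
Lemma moebius_transfer_ineq (C M : R) a b x y' :
  1 <= C -> 1 <= M -> (forall t, 0 <= t <= 2 * C -> theta t <= M) ->
  G a -> G b -> G x -> a != b -> boundary G' y' ->
  `|x - a| <= C * `|a - b| ->
  (forall y, boundary G y -> `|x - a| * `|b - y| <= C * `|x - y| * `|a - b|) ->
  `|f x - f a| * `|f b - y'| <= M * `|f x - y'| * `|f a - f b|.
Proof.
move=> C1 M1 MT Ga Gb Gx ab bG' xa xP.
have nab : 0 < `|a - b| by rewrite normr_gt0 subr_eq0.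
have near e : 0 < e -> exists z, [/\ G z, `|f z - y'| < e &
    `|x - a| * `|b - z| <= 2 * C * `|x - z| * `|a - b|].
  move=> e0; case: (boundary_preimage Ga Gb ab bG') => [[y bG near]|far].
    have xy : 0 < `|x - y|.
      rewrite normr_gt0 subr_eq0; apply/eqP => xy.
      by apply: (boundary_not_in Go bG); rewrite -xy.
    have den : 0 < `|x - a| + 2 * C * `|a - b|.
      by rewrite ltr_wpDl// !mulr_gt0//; lra.
    pose d := C * `|x - y| * `|a - b| / (`|x - a| + 2 * C * `|a - b|).
    have d0 : 0 < d by rewrite /d divr_gt0// !mulr_gt0//; lra.
    have dE : d * (`|x - a| + 2 * C * `|a - b|) = C * `|x - y| * `|a - b|.
      by rewrite /d divfK// gt_eqF.
    have [|z [Gz zy fz]] := near (Order.min e d); first by rewrite lt_min e0.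
    move: zy fz; rewrite !lt_min => /andP[_ zy] /andP[fz _].
    exists z; split=> //.
    have bz : `|b - z| <= `|b - y| + d.
      by have := ler_distD y b z; rewrite (distrC y z); lra.
    have xz : `|x - y| - d <= `|x - z| by have := ler_distD z x y; lra.
    have h1 : `|x - a| * `|b - z| <= `|x - a| * (`|b - y| + d) by exact: ler_wpM2l.
    have h2 : 2 * C * (`|x - y| - d) * `|a - b| <= 2 * C * `|x - z| * `|a - b|.
      by apply: ler_wpM2r => //; apply: ler_wpM2l => //; lra.
    by have := xP _ bG; lra.
  have [z [Gz Kz fz]] := far e (`|b| + 2 * `|x|) e0.
  exists z; split=> //.
  have h1 : `|b - z| <= 2 * `|x - z|.
    have := ler_normB b z; have := lerB_dist z x; rewrite (distrC z x); lra.
  have h2 : `|x - a| * `|b - z| <= C * `|a - b| * (2 * `|x - z|) by exact: ler_pM.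
  by lra.
apply/ler_addgt0Pr => e e0.
have den : 0 < M * `|f a - f b| + `|f x - f a| + 1.
  by rewrite ltr_wpDl// addr_ge0// mulr_ge0//; lra.
have [z [Gz fz]] := near _ (divr_gt0 e0 den); rewrite (distrC b z).
move=> /(quasimobius_bound M1 MT Gx Gz Ga Gb).
move: fz; set d := e / _ => fz h.
have dE : d * (M * `|f a - f b| + `|f x - f a| + 1) = e by rewrite /d divfK// gt_eqF.
have d0 : 0 < d by rewrite /d divr_gt0.
have bz : `|f b - y'| <= `|f z - f b| + d.
  by have := ler_distD (f z) (f b) y'; rewrite (distrC (f b) (f z)); lra.
have xz : `|f x - f z| <= `|f x - y'| + d.
  by have := ler_distD y' (f x) (f z); rewrite (distrC y' (f z)); lra.
have h1 : `|f x - f a| * `|f b - y'| <= `|f x - f a| * (`|f z - f b| + d).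
  exact: ler_wpM2l.
have h2 : M * `|f x - f z| * `|f a - f b| <= M * (`|f x - y'| + d) * `|f a - f b|.
  by apply: ler_wpM2r => //; apply: ler_wpM2l => //; lra.
by lra.
Qed.

Lemma moebius_transfer (C M : R) : 1 <= C -> 1 <= M ->
  (forall t, 0 <= t <= 2 * C -> theta t <= M) ->
  bounded_moebius_uniform C G -> moebius_uniform M G'.
Proof.
move=> C1 M1 MT GC x1' x2' G1' G2' x12'.
have G1 := gG G1'; have G2 := gG G2'.
have x12 : g x1' != g x2'.
  by apply: contra x12' => /eqP gx; rewrite -(gK G1') gx gK.
have [h hA] := GC _ _ G1 G2 x12; have [_ _ _ h0 h1] := hA.
have hG t : 0 <= t <= 1 -> G (h t) by move=> t01; have [[]] := arc_in hA t01.
exists (f \o h); split.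
- refine (@within_continuous_comp_within R E E' _ G h f (arc_cont hA) fc _).
  by move=> t /=; rewrite in_itv /=; exact: hG.
- move=> s t; rewrite !in_itv /= => s01 t01 /(homeo_inj (hG _ s01) (hG _ t01)).
  exact: arc_inj hA s01 t01.
- move=> _ /subarcP[t t01 <-] /=.
  have [[Gx xP] [X1 X2]] := arc_in hA t01.
  split=> [|y' bG']; first exact: fG.
  rewrite -(gK G1') -(gK G2'); split.
    apply: (moebius_transfer_ineq C1 M1 MT) => // y /xP[]//.
  rewrite (distrC (f (g x1')) (f (g x2'))).
  apply: (moebius_transfer_ineq C1 M1 MT) => //; first by rewrite eq_sym.
    by rewrite (distrC (g x2')).
  by move=> y /xP[_]; rewrite (distrC (g x2')).
- by rewrite /= h0 gK.
- by rewrite /= h1 gK.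
Qed.

End Transfer.

(** * Carrots *)

Section Carrots.
Variables (R : realType) (E : normedModType R) (G : set E).
Implicit Types (a b x y z : E) (c C : R) (f : R -> E).
Hypothesis Go : open G.

(** One of |x1 - y| and |x2 - y| is at least |x1 - x2| / 2. *)
Lemma moebius_cigar C x1 x2 x y : x1 != x2 -> moebius_region C G x1 x2 x ->
  boundary G y ->
  `|x - x1| <= 2 * C * `|x - y| \/ `|x - x2| <= 2 * C * `|x - y|.
Proof.
move=> x12 [_ xP] /xP[h1 h2].
have r0 : 0 < `|x1 - x2| by rewrite normr_gt0 subr_eq0.
have := ler_distD y x1 x2; rewrite (distrC y x2) => tr.
have half (X Y : R) : 0 <= X -> `|x1 - x2| / 2 <= Y ->
    X * Y <= C * `|x - y| * `|x1 - x2| -> X <= 2 * C * `|x - y|.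
  move=> X0 Yr XY; rewrite -(ler_pM2r r0).
  have : X * (`|x1 - x2| / 2) <= X * Y by exact: ler_wpM2l.
  lra.
have [Yr|Yr] := leP (`|x1 - x2| / 2) `|x2 - y|; [left|right].
  exact: half h1.
by apply: half h2 => //; lra.
Qed.

(** The distance to the initial point replaces the diameter of the initial
    subarc, at the cost of a factor 2. *)
Definition carrot A f := forall s t y, 0 <= s -> s <= t -> t <= 1 ->
  boundary G y -> `|f s - f 0| <= A * `|f t - y|.


Lemma carrot_constant_ge1 (A C kappa L : R) : 1 <= C -> 1 <= L -> 0 < kappa ->
  kappa <= 1 -> A * kappa = 6 * C * L * (1 + 2 * C) -> 1 <= A.
Proof.
move=> C1 L1 kappa0 kappa1 AE.
rewrite -(ler_pM2r kappa0) mul1r AE; apply: le_trans kappa1 _.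
have CL : 1 <= C * L by rewrite -[1]mulr1; apply: ler_pM.
have : 0 <= (C * L) * C by apply: mulr_ge0; lra.
by lra.
Qed.

(** The carrot [f] ends at [z'], on a sphere about [x1] smaller by the factor
    2 L, and is continued by an arc from [z'] to [z] given by uniformity.  Both
    endpoints of that arc are at distance of order [rho] from the boundary, so
    are all its points, and they stay within distance of order [rho] of [x1].
    Splicing preserves the initial subarcs of [f]. *)
Lemma carrot_step (A C kappa L rho : R) x1 z z' f : 1 <= C -> 1 <= L ->
  0 < kappa -> A * kappa = 6 * C * L * (1 + 2 * C) ->
  bounded_moebius_uniform C G -> 0 < rho -> G z -> `|z - x1| = rho ->
  (forall y, boundary G y -> kappa * rho <= `|z - y|) ->
  G z' -> `|z' - x1| = rho / (2 * L) ->
  (forall y, boundary G y -> kappa * (rho / (2 * L)) <= `|z' - y|) ->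
  arc_joining G x1 z' f -> carrot A f ->
  (forall s, 0 <= s <= 1 -> `|f s - x1| <= 3 * C * `|z' - x1|) ->
  exists h, [/\ arc_joining G x1 z h, carrot A h &
    forall s, 0 <= s <= 1 -> `|h s - x1| <= 3 * C * `|z - x1|].
Proof.
move=> C1 L1 kappa0 AE GC rho0 Gz zx zy Gz' zx' zy' fG fcar fb.
set rho' := rho / (2 * L) in zx' zy'.
have rho'E : rho = 2 * L * rho' by rewrite /rho' mulrC divfK// gt_eqF//; lra.
have rho'0 : 0 < rho' by rewrite /rho' divr_gt0//; lra.
have rho'h : 2 * rho' <= rho by rewrite rho'E -mulrA ler_pM2l// ler_peMl// ltW.
have [_ _ _ f0 f1] := fG.
have zz' : z != z'.
  apply: contraTneq rho'h => zz; rewrite -ltNge; have : rho = rho' by rewrite -zx zz zx'.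
  by lra.
have dzz' : `|z - z'| <= rho + rho'.
  by have := ler_distD x1 z z'; rewrite zx (distrC x1 z') zx'.
have [g gA] := GC _ _ Gz Gz' zz'.
have x1z : x1 != z by rewrite eq_sym -subr_eq0 -normr_gt0 zx.
have [h [hA hP]] := arc_splice fG gA x1z; have [_ _ _ h0 h1] := hA.
have hb s : 0 <= s <= 1 -> `|h s - x1| <= 3 * C * rho.
  move=> s01; have [[t [t01 -> _]]|[t [t01 -> _]]] := hP _ s01.
    apply: le_trans (fb _ t01) _; rewrite zx'; apply: ler_wpM2l; lra.
  have [_ [_ gz']] := arc_in gA t01.
  have tr := ler_distD z' (g t) x1.
  have h2 : C * `|z - z'| <= C * (rho + rho') by apply: ler_wpM2l => //; lra.
  have h3 : rho <= C * rho by rewrite ler_peMl// ltW.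
  have h4 : C * (2 * rho') <= C * rho by apply: ler_wpM2l => //; lra.
  by rewrite zx' in tr; lra.
exists h; split.
- apply: (arc_restr _ hA) => t t01.
  by have [Gh|[[Gh _] _]] := arc_in hA t01.
- move=> s t y s0 st t1 bGy; rewrite h0.
  have t01 : 0 <= t <= 1 by lra.
  have [[u [u01 -> hu]]|[u [u01 -> hu]]] := hP _ t01.
    have /hu /subarcP[v /andP[v0 vu] <-] : subarc h 0 t (h s).
      by apply/subarcP; exists s; rewrite ?s0.
    by rewrite -f0; apply: fcar => //; lra.
  have s01 : 0 <= s <= 1 by lra.
  apply: le_trans (hb _ s01) _.
  have [gg _] := arc_in gA u01.
  have far : kappa * rho' <= (1 + 2 * C) * `|g u - y|.
    have kk : kappa * rho' <= kappa * rho by rewrite ler_pM2l//; lra.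
    have [|] := moebius_cigar zz' gg bGy => near.
      by have := zy _ bGy; have := ler_distD (g u) z y; rewrite (distrC z (g u)); lra.
    by have := zy' _ bGy; have := ler_distD (g u) z' y; rewrite (distrC z' (g u)); lra.
  rewrite -(ler_pM2r kappa0) [in leRHS]mulrAC AE.
  have -> : 3 * C * rho * kappa = 6 * C * L * (kappa * rho') by rewrite rho'E; ring.
  rewrite -[leRHS]mulrA; apply: ler_wpM2l far.
  by rewrite !mulr_ge0//; lra.
- by rewrite zx.
Qed.

(** On a segment of length at most [d] starting at [x1] the distance to the
    boundary is at least [d]. *)
Lemma carrot_base (A C d : R) x1 z : 1 <= A -> 1 <= C -> 0 < d -> (forall x, `|x - x1| < 2 * d -> G x) ->
  0 < `|z - x1| <= d ->
  exists h, [/\ arc_joining G x1 z h, carrot A h &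
    forall s, 0 <= s <= 1 -> `|h s - x1| <= 3 * C * `|z - x1|].
Proof.
move=> A1 C1 d0 dG /andP[z0 zd].
have x1z : x1 != z by rewrite eq_sym -subr_eq0 -normr_gt0.
pose h (t : R) := x1 + t *: (z - x1).
have hz t : 0 <= t <= 1 -> `|h t - x1| <= `|z - x1|.
  move=> t01; apply: segment_norm_le => //.
  by rewrite subrr normr0.
exists h; split.
- apply: segment_arc => // t t01; apply: dG.
  by have := hz _ t01; rewrite /h; lra.
- move=> s t y s0 st t1 bGy; rewrite {2}/h scale0r addr0.
  have s01 : 0 <= s <= 1 by lra.
  have t01 : 0 <= t <= 1 by lra.
  apply: le_trans (hz _ s01) _.
  have yd : 2 * d <= `|y - x1|.
    by rewrite leNgt; apply/negP => /dG; exact: boundary_not_in.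
  have := ler_distD (h t) y x1; rewrite (distrC y (h t)).
  have := hz _ t01 => h1 h2.
  have : 1 * `|h t - y| <= A * `|h t - y| by apply: ler_wpM2r.
  lra.
- move=> s /hz /le_trans; apply.
  by rewrite ler_peMl//; lra.
Qed.

(** Induction on the number of spheres of ratio 2 L between the ball of
    [carrot_base] and [z]; the constant [A] does not depend on that number. *)
Lemma carrot_exists (A C kappa L r0 : R) x1 z : 1 <= C -> 1 <= L -> 0 < kappa ->
  kappa <= 1 -> A * kappa = 6 * C * L * (1 + 2 * C) ->
  bounded_moebius_uniform C G -> G x1 ->
  (forall rho, 0 < rho <= r0 -> exists z, [/\ G z, `|z - x1| = rho &
    forall y, boundary G y -> kappa * rho <= `|z - y|]) ->
  G z -> 0 < `|z - x1| <= L * r0 ->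
  (forall y, boundary G y -> kappa * `|z - x1| <= `|z - y|) ->
  exists h, [/\ arc_joining G x1 z h, carrot A h &
    forall s, 0 <= s <= 1 -> `|h s - x1| <= 3 * C * `|z - x1|].
Proof.
move=> C1 L1 kappa0 kappa1 AE GC Gx1 shells.
have A1 := carrot_constant_ge1 C1 L1 kappa0 kappa1 AE.
have /nbhs_ballP[e /= e0 eG] : nbhs x1 G by exact: open_nbhs_nbhs.
pose d := e / 2; have d0 : 0 < d by rewrite /d divr_gt0.
have dG x : `|x - x1| < 2 * d -> G x.
  by move=> xd; apply: eG; rewrite -ball_normE /= distrC; move: xd; rewrite /d; lra.
have L20 : 0 < 2 * L by lra.
have main k : forall z, G z -> 0 < `|z - x1| <= L * r0 ->
    `|z - x1| <= (2 * L) ^+ k * d ->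
    (forall y, boundary G y -> kappa * `|z - x1| <= `|z - y|) ->
    exists h, [/\ arc_joining G x1 z h, carrot A h &
      forall s, 0 <= s <= 1 -> `|h s - x1| <= 3 * C * `|z - x1|].
  elim: k => [|k IH] {}z Gz /andP[z0 zr] zk zy.
    by rewrite expr0 mul1r in zk; apply: (carrot_base A1 C1 d0) => //; rewrite z0.
  have q0 : 0 < `|z - x1| / (2 * L) by rewrite divr_gt0.
  have [|z' [Gz' zx' zy']] := shells (`|z - x1| / (2 * L)).
    by rewrite q0 ler_pdivrMr//; nra.
  have [|||h [hG hc hb]] := IH _ Gz'.
  - by rewrite zx' q0 ler_pdivrMr//; nra.
  - by rewrite zx' ler_pdivrMr// mulrAC -exprSr.
  - by move=> y /zy'; rewrite zx'.
  - exact: (carrot_step C1 L1 kappa0 AE GC z0 Gz _ _ Gz' zx' zy' hG hc hb).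
move=> Gz zr zy.
pose k := Num.Def.archi_bound (`|z - x1| / d).
apply: (main k) => //; rewrite -ler_pdivrMr//.
apply: le_trans (ltW (upper_nthrootP (leqnn k))) _.
by apply: lerXn2r; rewrite ?nnegrE; lra.
Qed.

End Carrots.

(** * Diameter uniformity and the theorem *)

Section Diameter.
Variables (R : realType) (E : normedModType R) (G : set E).
Implicit Types (a b x y z m : E) (c C : R) (f : R -> E).
Hypothesis Go : open G.

(** On the sphere of radius [rho] about [x1] the arc is at least as far from
    [x2] as from [x1], so the boundary is at distance at least rho / (2 C). *)
Lemma arc_shells C x1 x2 f : 1 <= C -> x1 != x2 ->
  arc_joining (moebius_region C G x1 x2) x1 x2 f ->
  forall rho, 0 < rho <= `|x1 - x2| / 2 -> exists z, [/\ G z, `|z - x1| = rho &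
    forall y, boundary G y -> (2 * C)^-1 * rho <= `|z - y|].
Proof.
move=> C1 x12 fA rho /andP[rho0 rhor]; have [_ _ _ f0 f1] := fA.
have [|t] := IVT ler01 (continuous_dist (p := x1) (arc_cont fA)) (v := rho).
  rewrite f0 f1 subrr normr0 distrC ge_min le_max (ltW rho0) /=.
  by apply/orP; right; lra.
rewrite in_itv /= => t01 ft; have zA := arc_in fA t01.
exists (f t); split=> //; first by case: zA.
move=> y bGy; rewrite mulrC ler_pdivrMr; last lra.
have tr := ler_distD (f t) x1 x2; rewrite (distrC x1 (f t)) in tr.
by have [|] := moebius_cigar x12 zA bGy; lra.
Qed.

Lemma arc_midpoint A x1 x2 f : arc_joining A x1 x2 f ->
  exists2 m, A m & `|m - x1| = `|m - x2|.
Proof.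
move=> fA; have [_ _ _ f0 f1] := fA.
have fc := arc_cont fA.
have dc : {within `[0, 1], continuous (fun t => `|f t - x1| - `|f t - x2|)}.
  apply: within_continuousB; exact: continuous_dist.
have [|t] := IVT ler01 dc (v := 0).
  rewrite f0 f1 !subrr !normr0 sub0r subr0 ge_min le_max oppr_le0.
  by rewrite !normr_ge0 orbT.
rewrite in_itv /= => t01 /eqP; rewrite subr_eq0 => /eqP ft.
by exists (f t) => //; exact: arc_in fA t01.
Qed.

Lemma diam_le f (s t rho : R) x : (forall u, s <= u <= t -> `|f u - x| <= rho) ->
  (diam (subarc f s t : set E) <= (2 * rho)%:E)%E.
Proof.
move=> fx; apply: ge_ereal_sup => _ [a [b [/subarcP[u su <-] /subarcP[v sv <-] ->]]].
rewrite lee_fin; have := ler_distD x (f u) (f v); rewrite (distrC x).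
by have := fx _ su; have := fx _ sv; lra.
Qed.

(** Carrots are built from [x1] and from [x2] to a point [m] of the arc at equal
    distance from both, and spliced. *)
Lemma bounded_moebius_diameter C : 1 <= C -> bounded_moebius_uniform C G ->
  diameter_uniform (48 * C ^+ 3 * (1 + 2 * C) + 6 * C ^+ 2 + 2) G.
Proof.
move=> C1 GC x1 x2 Gx1 Gx2 x12.
have [f fA] := GC _ _ Gx1 Gx2 x12.
have fM : arc_joining (moebius_region C G x1 x2) x1 x2 f.
  by apply: arc_sub fA => x [].
set r := `|x1 - x2|; have r0 : 0 < r by rewrite /r normr_gt0 subr_eq0.
have [m [mM [m1 m2]] m12] := arc_midpoint fA.
have Gm : G m by case: mM.
have mr : r / 2 <= `|m - x1|.
  by have := ler_distD m x1 x2; rewrite (distrC x1 m) -/r; lra.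
have C3 : 0 <= C ^+ 3 by rewrite exprn_ge0//; lra.
have C2 : 1 <= C ^+ 2 by rewrite exprn_ege1.
pose A := 24 * C ^+ 3 * (1 + 2 * C).
have A0 : 0 <= A by rewrite /A mulr_ge0//; lra.
have C20 : 0 < (2 * C)^-1 by rewrite invr_gt0; lra.
have C21 : (2 * C)^-1 <= 1 by rewrite invf_le1; lra.
have L1 : 1 <= 2 * C by lra.
have AE : A * (2 * C)^-1 = 6 * C * (2 * C) * (1 + 2 * C).
  by rewrite /A; field; lra.
have mb y : boundary G y -> (2 * C)^-1 * `|m - x1| <= `|m - y|.
  move=> bGy; rewrite mulrC ler_pdivrMr; last lra.
  by have [|] := moebius_cigar x12 mM bGy; rewrite -?m12; lra.
have rL : `|m - x1| <= (2 * C) * (r / 2) by move: m1; rewrite -/r; lra.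
have [|b1 [b1G b1c b1b]] := carrot_exists Go C1 L1 C20 C21 AE GC Gx1
    (arc_shells C1 x12 fM) Gm _ mb.
  by rewrite -/r rL andbT; lra.
have x21 : x2 != x1 by rewrite eq_sym.
have fM' : arc_joining (moebius_region C G x2 x1) x2 x1 (fun t => f (1 - t)).
  by apply: arc_sub (arc_rev fM) => x; exact: moebius_region_sym.
have mb2 y : boundary G y -> (2 * C)^-1 * `|m - x2| <= `|m - y|.
  by rewrite -m12; exact: mb.
have [|b2 [b2G b2c b2b]] := carrot_exists Go C1 L1 C20 C21 AE GC Gx2
    (arc_shells C1 x21 fM') Gm _ mb2.
  by rewrite -m12 (distrC x2) -/r rL andbT; lra.
have [h [hA hP]] := arc_splice b1G b2G x12.
have [_ _ _ b10 _] := b1G; have [_ _ _ b20 _] := b2G.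
have m1' : 3 * C * `|m - x1| <= 3 * C ^+ 2 * r.
  rewrite expr2 !mulrA -[X in _ <= X]mulrA; apply: ler_wpM2l => //; lra.
exists h; split.
- by apply: arc_sub hA => x [].
- apply: (@le_trans _ _ (2 * ((3 * C ^+ 2 + 1) * r))%:E).
    apply: (@diam_le _ _ _ _ x1) => u u01.
    have [[t [t01 -> _]]|[t [t01 -> _]]] := hP _ u01.
      by have := b1b _ t01; lra.
    have := b2b _ t01; rewrite -m12.
    by have := ler_distD x2 (b2 t) x1; rewrite (distrC x2 x1) -/r; lra.
  rewrite lee_fin.
  have : 0 <= A * r by rewrite mulr_ge0// ltW.
  by rewrite /A; lra.
move=> u u01; have /andP[u0 u1] := u01.
set c := _ + 2; have c0 : 0 < c by rewrite /c; move: A0; rewrite /A; lra.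
rewrite -lee_pdivrMl//; apply: le_ereal_inf_tmp => _ [y bGy <-].
rewrite lee_pdivrMl// -EFinM.
have Ac : 2 * (A * `|h u - y|) <= c * `|h u - y|.
  by rewrite mulrA; apply: ler_wpM2r => //; rewrite /A /c; lra.
rewrite ge_min; have [[t [t01 huE hu]]|[t [t01 huE hu]]] := hP _ u01; apply/orP; [left|right].
  apply: (@le_trans _ _ (2 * (A * `|h u - y|))%:E); last by rewrite lee_fin.
  apply: (@diam_le _ _ _ _ x1) => v v01.
  have /hu /subarcP[s /andP[s0 st] <-] : subarc h 0 u (h v) by apply/subarcP; exists v.
  rewrite -b10 huE; apply: b1c => //; lra.
apply: (@le_trans _ _ (2 * (A * `|h u - y|))%:E); last by rewrite lee_fin.
apply: (@diam_le _ _ _ _ x2) => v v01.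
have /hu /subarcP[s /andP[s0 st] <-] : subarc h u 1 (h v) by apply/subarcP; exists v.
rewrite -b20 huE; apply: b2c => //; lra.
Qed.

End Diameter.

Theorem corollary1p1 (R : realType) (theta : R -> R)
  (htheta : homeomorphism_onto [set t : R | 0 <= t] [set t : R | 0 <= t] theta) :
  (forall c : R, 1 <= c ->
     exists c' : R, 1 <= c' /\
       forall (E E' : completeNormedModType R) (G : set E) (G' : set E')
              (f : E -> E'),
         dim_ge2 E -> dim_ge2 E' ->
         domain G -> G <> setT -> domain G' -> G' <> setT ->
         homeomorphism_onto G G' f -> quasimobius theta G f ->
         diameter_uniform c G -> diameter_uniform c' G')
  /\
  (forall delta : R, 0 < delta < 1 ->
     exists delta' : R, 0 < delta' < 1 /\
       forall (E E' : completeNormedModType R) (G : set E) (G' : set E')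
              (f : E -> E'),
         dim_ge2 E -> dim_ge2 E' ->
         domain G -> G <> setT -> domain G' -> G' <> setT ->
         homeomorphism_onto G G' f -> quasimobius theta G f ->
         delta_uniform delta G -> delta_uniform delta' G').
Proof.
have bound T : 0 <= T -> exists M, 1 <= M /\ forall t, 0 <= t <= T -> theta t <= M.
  exact: homeomorphism_bounded.
split=> [c c1|delta d01].
  have C1 : 1 <= c * (c + 2) by nra.
  have [|M [M1 MT]] := bound (2 * (c * (c + 2))); first lra.
  have C2 : 1 <= 201 * M by lra.
  eexists; split; last first.
    move=> E E' G G' f _ dimE' [Go _ _] _ [G'o _ _] _ [g [[fc _] fG gG fK gK]] fqm Gc.
    apply: (bounded_moebius_diameter G'o C2).
    apply: moebius_bounded => //.
    apply: (moebius_transfer bound Go G'o fc fG gG fK gK fqm C1 M1 MT).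
    exact: diameter_bounded_moebius.
  have : 0 <= (201 * M) ^+ 3 by rewrite exprn_ge0//; lra.
  have : 0 <= (201 * M) ^+ 2 by rewrite exprn_ge0//; lra.
  move=> h2 h3; have : 0 <= 48 * (201 * M) ^+ 3 * (1 + 2 * (201 * M)).
    by rewrite mulr_ge0//; lra.
  by lra.
have /andP[d0 d1] := d01.
have C1 : 1 <= 201 * delta^-1.
  have : 1 <= delta^-1 by rewrite invf_ge1// ltW.
  lra.
have [|M [M1 MT]] := bound (2 * (201 * delta^-1)); first lra.
exists (2 * (201 * M))^-1; split.
  by rewrite invr_gt0 invf_lt1; lra.
move=> E E' G G' f dimE dimE' [Go _ _] _ [G'o _ _] _ [g [[fc _] fG gG fK gK]] fqm Gd.
apply: bounded_moebius_delta => //; first lra.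
apply: moebius_bounded => //.
apply: (moebius_transfer bound Go G'o fc fG gG fK gK fqm C1 M1 MT).
apply: moebius_bounded => //; first by rewrite invf_ge1// ltW.
exact: delta_moebius.
Qed.
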